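(* Let $0<p\le 1$ be fixed and let $\alpha_1\ge\alpha_2\ge\alpha_3>0$. Then asymptotically almost surely \[ \mathcal{G}((2\alpha_1+\alpha_2+\alpha_3+o(1))n,p) \to (C_{2\lfloor\alpha_1n\rfloor},C_{2\lfloor\alpha_2n\rfloor},C_{2\lfloor\alpha_3n\rfloor}), \] and \[ \mathcal{G}((2\alpha_1+\alpha_2+o(1))n,p) \to (C_{2\lfloor\alpha_1n\rfloor},C_{2\lfloor\alpha_2n\rfloor}). \]
   Context: $C_k$ denotes the cycle of length $k$. For graphs $F,G_1,\dots,G_k$, we write $F\to(G_1,\dots,G_k)$ if every coloring of the edges of $F$ with $k$ colors yields, for some $1\le i\le k$, a copy of $G_i$ all of whose edges have color $i$. The random graph $\mathcal{G}(N,p)$ is the graph on vertex set $\{1,\dots,N\}$ in which each pair $\{i,j\}$ is an edge independently with probability $p$. An event occurs asymptotically almost surely (a.a.s.) if its probability tends to $1$ as $n\to\infty$; $o(1)$ denotes a quantity tending to $0$ as $n\to\infty$. *)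

(* Defs.v *)
From HB Require Import structures.
From mathcomp Require Import all_boot all_order all_algebra.
From mathcomp Require Import all_classical all_reals all_analysis.
Set Implicit Arguments.
Unset Strict Implicit.
Unset Printing Implicit Defensive.
Import Order.TTheory GRing.Theory Num.Theory.
Import numFieldNormedType.Exports.
Local Open Scope ring_scope.

Definition pairs (T : finType) : {set {set T}} := [set e : {set T} | #|e| == 2].

(* Vertices are labelled by ordinals so that graphs form a small type and can be
   collected in tuples. *)
Record sgraph := SGraph {
  nvert : nat;
  edges : {set {set 'I_nvert}};
  edges_pairs : edges \subset pairs 'I_nvert }.

Notation vert F := 'I_(nvert F).

(* The simple graph on 'I_N whose edges are the two-element members of E. *)
Definition mk_sgraph (N : nat) (E : {set {set 'I_N}}) : sgraph :=
  @SGraph N (E :&: pairs 'I_N) (subsetIr E (pairs 'I_N)).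

(* This is the cycle of length k for 3 <= k; ordS is the successor modulo k. *)
Definition cycle_graph (k : nat) : sgraph :=
  mk_sgraph [set [set i; ordS i] | i : 'I_k].

(* F has a (not necessarily induced) subgraph isomorphic to G. *)
Definition has_copy (F G : sgraph) : bool :=
  [exists f : {ffun vert G -> vert F},
     injectiveb f && [forall (e | e \in edges G), f @: e \in edges F]].

Definition color_class (F : sgraph) (k : nat) (c : {set vert F} -> 'I_k)
    (i : 'I_k) : sgraph :=
  mk_sgraph [set e in edges F | c e == i].

(* Colorings are defined on all vertex subsets; only their values on edges of F
   matter. *)
Definition arrows (F : sgraph) (k : nat) (G : k.-tuple sgraph) : bool :=
  [forall c : {ffun {set vert F} -> 'I_k},
     [exists i : 'I_k, has_copy (color_class c i) (tnth G i)]].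

Definition gnp_weight (R : realType) (N : nat) (p : R) (E : {set {set 'I_N}}) : R :=
  \prod_(e in pairs 'I_N) (if e \in E then p else 1 - p).

(* The probability that the random graph G(N,p) has property A. *)
Definition gnp_prob (R : realType) (N : nat) (p : R) (A : sgraph -> bool) : R :=
  \sum_(E in powerset (pairs 'I_N) | A (mk_sgraph E)) gnp_weight p E.

Lemma gnp_prob_total (R : realType) (N : nat) (p : R) :
  gnp_prob N p xpredT = 1.
Proof.
pose F e : R := if e \in pairs 'I_N then p else 0.
pose G e : R := if e \in pairs 'I_N then 1 - p else 1.
have : \prod_e (F e + G e) = \sum_(E in {set {set 'I_N}})
    \prod_e (if e \in E then F e else G e) by exact: bigA_distr.
rewrite big1 => [|e _]; last by rewrite /F /G; case: ifP; rewrite ?add0r ?subrKC.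
move=> ->; rewrite [RHS](bigID (fun E : {set {set 'I_N}} => E \subset pairs 'I_N)) /=.
rewrite [X in _ = _ + X]big1 => [|E /fintype.subsetPn[e eE eN]]; last first.
  by rewrite (bigD1 e) //= eE /F (negbTE eN) mul0r.
rewrite addr0; apply: eq_big => [E|E]; first by rewrite powersetE andbT.
rewrite powersetE andbT => /fintype.subsetP sE.
rewrite /gnp_weight big_mkcond; apply: eq_bigr => e _; rewrite /F /G.
by case: ifPn => // eN; case: ifP => // /sE; rewrite (negbTE eN).
Qed.

(* A sequence of events with probabilities P n holds asymptotically almost
   surely as n tends to infinity. *)
Definition aas (R : realType) (P : nat -> R) : Prop := (P @ \oo --> (1 : R))%classic.

(* "A.a.s. G((s + o(1)) n, p) has property A n": for some sequence e tending
   to 0 such that each N n = (s + e n) n is an integer. *)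
Definition aas_gnp (R : realType) (s p : R) (A : nat -> sgraph -> bool) : Prop :=
  exists (e : nat -> R) (N : nat -> nat),
    [/\ (e @ \oo --> (0 : R))%classic,
        forall n, (N n)%:R = (s + e n) * n%:R
      & aas (fun n => gnp_prob (N n) p (A n))].

(* Main.v *)
(** Each colour class [H] without a cycle of length [2m] is cleaned with
    Szemeredi's lemma: after the removal of few edges, every component carries a
    weight with values in {0, 1/2, 1}, of total at most about [m], such that the
    weights at the ends of each surviving edge add up to at least 1.  Indeed, by
    Koenig's theorem applied to the double cover of a component of the cluster
    graph, the alternative is a large partial injection [f] along its edges;
    zigzagging between [a] and [f a], for the clusters [a] in the domain of [f],
    gives a closed walk of length exactly [2m] that visits no cluster too often,
    and such walks embed greedily as cycles.

    A pigeonhole argument over the scales of component sizes leaves finitely many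
    types of vertices, a type recording the large component and the weight in
    each colour.  As any two linear-sized sets span a positive proportion of
    edges, any two types, equal or not, are compatible in some colour.  A finite
    case analysis, according to how the triples of components intersect, bounds
    the number of vertices by [m1 + m2 + m3 + max(m1, m2, m3)].  The statement for
    two colours is the case of an empty third colour. *)
Require Import Defs.
From mathcomp Require Import all_boot all_order all_algebra.
From mathcomp Require Import all_classical all_reals all_analysis.
From mathcomp Require Import zify ring lra.
Import Order.TTheory GRing.Theory Num.Theory.
Set Implicit Arguments.
Unset Strict Implicit.
Unset Printing Implicit Defensive.

(** * Covers of a complete graph in three colours *)

(** The bound on the number of vertices is an instance of linear programming duality. With weights
    doubled, each vertex should collect 2 from four loads: one component in each colour, and one of
    these counted a second time, which is where the maximum comes from. In one configuration, four
    triples of components meeting pairwise in exactly one colour, the sizes of the four parts have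
    to be compared as well.

    Passing to finitely many types needs a gap between component sizes. Components with at least
    [|V| / D] vertices are few, and components with fewer than [|V| / D'] vertices contain few
    pairs, but [D'] must be large in terms of the number of types, hence of [D]. So each scale is
    defined from the previous one, and the pigeonhole principle yields a scale with few vertices in
    between.

    The order of the constants matters: the density [1 / C] of the random graph depends on [p]
    alone, the divisor [K] and the threshold [h] are then found from [C] and the precision [q], and
    only then is the random graph asked to be quasirandom for sets of size [N / h]. *)

Ltac eqlia := repeat (match goal with |- context [nat_of_bool (?x == ?y) * _] =>
    case: (x =P y) => ?; rewrite /= ?mul1n ?mul0n ?add0n ?addn0 //= end);
  lia.

Section Extremal.
Variables (V : finType) (S : {set V}).

Definition at_label (c w : V -> nat) (l : nat) (v : V) := (c v == l) * w v.

(** Weak duality. Outside [four_parts_heavy], every final bound chooses one label in each colour and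
    takes one of the three twice; this produces the term [maxn b1 (maxn b2 b3)]. *)
Lemma weight_certificate (f1 f2 f3 f4 : V -> nat) (b1 b2 b3 b4 : nat) :
  \sum_(v in S) f1 v <= b1 -> \sum_(v in S) f2 v <= b2 ->
  \sum_(v in S) f3 v <= b3 -> \sum_(v in S) f4 v <= b4 ->
  (forall v, v \in S -> 2 <= f1 v + f2 v + f3 v + f4 v) ->
  2 * #|S| <= b1 + b2 + b3 + b4.
Proof.
move=> h1 h2 h3 h4 h.
have : \sum_(v in S) 2 <= \sum_(v in S) (f1 v + f2 v + f3 v + f4 v).
  by apply: leq_sum => v /h.
rewrite sum_nat_const !big_split /= => h'; lia.
Qed.

(* Weights are doubled: 0, 1, 2 stand for 0, 1/2, 1.  The case [u = v] is included,
   so every vertex has positive weight in some colour. *)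
Definition jointly_adjacent (c1 c2 c3 w1 w2 w3 : V -> nat) :=
  forall u v, u \in S -> v \in S ->
  [|| (c1 u == c1 v) && (2 <= w1 u + w1 v),
      (c2 u == c2 v) && (2 <= w2 u + w2 v)
    | (c3 u == c3 v) && (2 <= w3 u + w3 v)].

Definition load_bound (c w : V -> nat) (b : nat) :=
  forall l, \sum_(v in S) at_label c w l v <= b.

Lemma jointly_adjacent_swap12 c1 c2 c3 w1 w2 w3 :
  jointly_adjacent c1 c2 c3 w1 w2 w3 -> jointly_adjacent c2 c1 c3 w2 w1 w3.
Proof. by move=> H u v uS vS; have := H u v uS vS; lia. Qed.

Lemma jointly_adjacent_swap23 c1 c2 c3 w1 w2 w3 :
  jointly_adjacent c1 c2 c3 w1 w2 w3 -> jointly_adjacent c1 c3 c2 w1 w3 w2.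
Proof. by move=> H u v uS vS; have := H u v uS vS; lia. Qed.

Lemma ex_or_all (P : pred V) :
  (exists2 v, v \in S & P v) \/ (forall v, v \in S -> ~~ P v).
Proof.
have [/existsP[v /andP[vS Pv]]|/existsPn h] := boolP [exists v, (v \in S) && P v].
  by left; exists v.
by right => v vS; have := h v; rewrite vS.
Qed.

(** Vertices of weight 0 in colour 1 can be joined to one another only in colours 2 and 3. The
    assertion [leaf1], [leaf2] or [leaf3] is the certificate that doubles colour 1, 2 or 3. The case
    split looks for vertices of small weight: being joined to such a vertex forces weight on all the
    others. *)
Lemma star_zero_spanned c1 c2 c3 w1 w2 w3 b1 b2 b3 a b :
  jointly_adjacent c1 c2 c3 w1 w2 w3 ->
  load_bound c1 w1 b1 -> load_bound c2 w2 b2 -> load_bound c3 w3 b3 ->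
  (forall v, v \in S -> c1 v = a) ->
  (forall v, v \in S -> w1 v = 0 -> c2 v = b) ->
  2 * #|S| <= b1 + b2 + b3 + maxn b1 (maxn b2 b3).
Proof.
move=> H B1 B2 B3 ha hb.
have leaf1 c : (forall v, v \in S -> 2 <= at_label c1 w1 a v + at_label c1 w1 a v
      + at_label c2 w2 b v + at_label c3 w3 c v) ->
   2 * #|S| <= b1 + b2 + b3 + maxn b1 (maxn b2 b3).
  move=> h; have := weight_certificate (B1 a) (B1 a) (B2 b) (B3 c) h; lia.
have leaf2 c : (forall v, v \in S -> 2 <= at_label c1 w1 a v + at_label c2 w2 b v
      + at_label c2 w2 b v + at_label c3 w3 c v) ->
   2 * #|S| <= b1 + b2 + b3 + maxn b1 (maxn b2 b3).
  move=> h; have := weight_certificate (B1 a) (B2 b) (B2 b) (B3 c) h; lia.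
have leaf3 c : (forall v, v \in S -> 2 <= at_label c1 w1 a v + at_label c2 w2 b v
      + at_label c3 w3 c v + at_label c3 w3 c v) ->
   2 * #|S| <= b1 + b2 + b3 + maxn b1 (maxn b2 b3).
  move=> h; have := weight_certificate (B1 a) (B2 b) (B3 c) (B3 c) h; lia.
rewrite /at_label in leaf1 leaf2 leaf3.
case: (ex_or_all (fun v => (w1 v == 0) && (w2 v == 0))) => [[z0 z0S hz0]|noZ0]; last first.
  case: (ex_or_all (fun v => (w1 v == 1) && ~~ ((c2 v == b) && (1 <= w2 v))))
    => [[u uS hu]|noU]; last first.
    (* Label 0 is a dummy for colour 3: here colours 1 and 2 already give 2. *)
    apply: (leaf2 0) => v vS; have := ha v vS; have := hb v vS.
    have := noZ0 v vS; have := noU v vS; eqlia.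
  case: (ex_or_all (fun v => (w1 v == 0) && (w2 v == 1))) => [[z zS hz]|noZ1]; last first.
    apply: (leaf1 0) => v vS; have := ha v vS; have := hb v vS.
    have := noZ0 v vS; have := noZ1 v vS; eqlia.
  case: (ex_or_all (fun v => [&& w1 v == 0, w2 v == 1 & w3 v == 0]))
    => [[z' z'S hz']|noZ'].
    apply: (leaf2 (c3 u)) => v vS; have := ha v vS; have := hb v vS.
    have := noZ0 v vS; have := H v z' vS z'S; have := H u z' uS z'S.
    have := hb z' z'S; have := ha u uS; have := ha z' z'S; eqlia.
  apply: (leaf1 (c3 u)) => v vS; have := ha v vS; have := hb v vS.
  have := noZ0 v vS; have := noZ' v vS; have := H v u vS uS.
  have := ha u uS; eqlia.
(* As [z0] has no weight in colours 1 and 2, every vertex of weight below 2 in both of them has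
   label [c] in colour 3. *)
set c := c3 z0.
case: (ex_or_all (fun v => [&& w1 v == 0, w2 v == 0 & w3 v <= 1])) => [[z zS hz]|noz].
  apply: (leaf3 c) => v vS; have := ha v vS; have := hb v vS.
  have := H v z vS zS; have := H z z0 zS z0S; have := H v z0 vS z0S.
  have := hb z zS; have := hb z0 z0S; have := H v v vS vS.
  have := ha z zS; have := ha z0 z0S; rewrite -/c; eqlia.
case: (ex_or_all (fun v => [&& w1 v == 0, w2 v == 1 & w3 v == 0])) => [[y yS hy]|noy].
  apply: (leaf2 c) => v vS; have := ha v vS; have := hb v vS.
  have := H v y vS yS; have := H y z0 yS z0S; have := H v z0 vS z0S.
  have := hb y yS; have := hb z0 z0S; have := noz v vS.
  have := ha y yS; have := ha z0 z0S; rewrite -/c; eqlia.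
apply: (leaf1 c) => v vS; have := ha v vS; have := hb v vS.
have := H v z0 vS z0S; have := hb z0 z0S; have := noz v vS; have := noy v vS.
have := ha z0 z0S; rewrite -/c; eqlia.
Qed.

(** The vertices of weight 0 in colour 1 pairwise share a label in colour 2 or in colour 3. Two
    equivalence relations whose union is everything cannot both be proper, so one of these colours
    has a single label on them. *)
Lemma star_extremal c1 c2 c3 w1 w2 w3 b1 b2 b3 a :
  jointly_adjacent c1 c2 c3 w1 w2 w3 ->
  load_bound c1 w1 b1 -> load_bound c2 w2 b2 -> load_bound c3 w3 b3 ->
  (forall v, v \in S -> c1 v = a) ->
  2 * #|S| <= b1 + b2 + b3 + maxn b1 (maxn b2 b3).
Proof.
move=> H B1 B2 B3 ha.
case: (ex_or_all (fun v => w1 v == 0)) => [[z zS hz]|noz]; last first.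
  apply: (star_zero_spanned (b := 0) H B1 B2 B3 ha) => v /noz /eqP; eqlia.
case: (ex_or_all (fun v => (w1 v == 0) && (c2 v != c2 z))) => [[x xS hx]|nox]; last first.
  apply: (star_zero_spanned (b := c2 z) H B1 B2 B3 ha) => v /nox; eqlia.
case: (ex_or_all (fun v => (w1 v == 0) && (c3 v != c3 z))) => [[y yS hy]|noy].
  have := H x y xS yS; have := H x z xS zS; have := H y z yS zS; eqlia.
have hz3 v : v \in S -> w1 v = 0 -> c3 v = c3 z by move=> /noy; eqlia.
have := star_zero_spanned (jointly_adjacent_swap23 H) B1 B3 B2 ha hz3; lia.
Qed.

Definition agree_twice (c1 c2 c3 : V -> nat) (a b c : nat) := forall v, v \in S ->
  2 <= (c1 v == a) + (c2 v == b) + (c3 v == c).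

(** Vertices off [a] all have labels [b] and [c]. Two of them whose weights add up to at most 1 in
    colour 2 and in colour 3 must therefore share their label in colour 1; this label replaces [a]
    in the certificate. *)
Lemma majority_deficient c1 c2 c3 w1 w2 w3 b1 b2 b3 a b c r :
  jointly_adjacent c1 c2 c3 w1 w2 w3 ->
  load_bound c1 w1 b1 -> load_bound c2 w2 b2 -> load_bound c3 w3 b3 ->
  agree_twice c1 c2 c3 a b c ->
  r \in S -> c1 r != a -> w2 r + w3 r <= 1 ->
  2 * #|S| <= b1 + b2 + b3 + maxn b1 (maxn b2 b3).
Proof.
move=> H B1 B2 B3 D rS ra rw.
have leaf1 a' : (forall v, v \in S -> 2 <= at_label c1 w1 a' v + at_label c1 w1 a' v
      + at_label c2 w2 b v + at_label c3 w3 c v) ->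
   2 * #|S| <= b1 + b2 + b3 + maxn b1 (maxn b2 b3).
  move=> h; have := weight_certificate (B1 a') (B1 a') (B2 b) (B3 c) h; lia.
have leaf2 a' : (forall v, v \in S -> 2 <= at_label c1 w1 a' v + at_label c2 w2 b v
      + at_label c2 w2 b v + at_label c3 w3 c v) ->
   2 * #|S| <= b1 + b2 + b3 + maxn b1 (maxn b2 b3).
  move=> h; have := weight_certificate (B1 a') (B2 b) (B2 b) (B3 c) h; lia.
have leaf3 a' : (forall v, v \in S -> 2 <= at_label c1 w1 a' v + at_label c2 w2 b v
      + at_label c3 w3 c v + at_label c3 w3 c v) ->
   2 * #|S| <= b1 + b2 + b3 + maxn b1 (maxn b2 b3).
  move=> h; have := weight_certificate (B1 a') (B2 b) (B3 c) (B3 c) h; lia.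
rewrite /at_label in leaf1 leaf2 leaf3.
have agr v : v \in S -> c1 v != a -> c2 v = b /\ c3 v = c by move=> vS va; have := D v vS; lia.
have loop v : v \in S -> [|| 0 < w1 v, 0 < w2 v | 0 < w3 v].
  by move=> vS; have := H v v vS vS; rewrite !eqxx /=; lia.
case: (ex_or_all (fun v => [&& c1 v != a, w2 v == 0 & w3 v == 0]))
  => [[x xS /and3P[xa /eqP xw2 /eqP xw3]]|noW].
  have [x2 x3] := agr x xS xa.
  case: (ex_or_all (fun v => [&& c1 v != a, w2 v == 0, w3 v == 0 & w1 v <= 1]))
    => [[y yS /and4P[ya /eqP yw2 /eqP yw3 yw1]]|noy].
    have [y2 y3] := agr y yS ya.
    have yx : c1 y = c1 x by have := H x y xS yS; rewrite xw2 yw2 xw3 yw3; lia.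
    apply: (leaf1 (c1 x)) => v vS; have := D v vS; have := loop v vS.
    have := H v x vS xS; have := H v y vS yS.
    rewrite yx x2 y2 x3 y3 xw2 yw2 xw3 yw3; eqlia.
  case: (ex_or_all (fun v => [&& c1 v != a, w2 v == 1, w3 v == 0 & w1 v == 0]))
    => [[y yS /and4P[ya /eqP yw2 /eqP yw3 /eqP yw1]]|noy'].
    have [y2 y3] := agr y yS ya.
    have yx : c1 y = c1 x by have := H x y xS yS; rewrite xw2 yw2 xw3 yw3; lia.
    apply: (leaf2 (c1 x)) => v vS; have := D v vS; have := noy v vS.
    have := H v x vS xS; have := H v y vS yS; have := loop v vS.
    rewrite yx x2 y2 x3 y3 xw2 yw2 xw3 yw3 yw1; eqlia.
  apply: (leaf3 (c1 x)) => v vS; have := D v vS.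
  have := H v x vS xS; have := noy v vS; have := noy' v vS; have := loop v vS.
  rewrite x2 x3 xw2 xw3; eqlia.
case: (ex_or_all (fun v => [&& c1 v != a, w2 v == 1 & w3 v == 0]))
  => [[x xS /and3P[xa /eqP xw2 /eqP xw3]]|noA2];
case: (ex_or_all (fun v => [&& c1 v != a, w2 v == 0 & w3 v == 1]))
  => [[y yS /and3P[ya /eqP yw2 /eqP yw3]]|noA3].
- have [x2 x3] := agr x xS xa; have [y2 y3] := agr y yS ya.
  have yx : c1 y = c1 x by have := H x y xS yS; rewrite xw2 yw2 xw3 yw3; lia.
  case: (ex_or_all (fun v => [&& c1 v != a, w2 v == 1, w3 v == 0 & w1 v == 0]))
    => [[z zS /and4P[za /eqP zw2 /eqP zw3 /eqP zw1]]|noz].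
    have [z2 z3] := agr z zS za.
    have zx : c1 z = c1 x by have := H y z yS zS; rewrite yx zw2 yw2 zw3 yw3; lia.
    apply: (leaf2 (c1 x)) => v vS; have := D v vS.
    have := H v x vS xS; have := H v y vS yS; have := H v z vS zS; have := noW v vS.
    rewrite zx yx x2 y2 z2 x3 y3 z3 xw2 yw2 zw2 xw3 yw3 zw3 zw1; eqlia.
  apply: (leaf3 (c1 x)) => v vS; have := D v vS.
  have := H v x vS xS; have := H v y vS yS; have := noW v vS; have := noz v vS.
  rewrite yx x2 y2 x3 y3 xw2 yw2 xw3 yw3; eqlia.
- have [x2 x3] := agr x xS xa.
  apply: (leaf2 0) => v vS; have := D v vS.
  have := H v x vS xS; have := noW v vS; have := noA3 v vS.
  rewrite x2 x3 xw2 xw3; eqlia.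
- have [y2 y3] := agr y yS ya.
  apply: (leaf3 0) => v vS; have := D v vS.
  have := H v y vS yS; have := noW v vS; have := noA2 v vS.
  rewrite y2 y3 yw2 yw3; eqlia.
by have := noW r rS; have := noA2 r rS; have := noA3 r rS; lia.
Qed.

(** A vertex labelled [(a, b, c)] of total weight 1 needs its colour doubled. All such vertices have
    their weight in the same colour, because two with weight in different colours would be joined in
    none. *)
Lemma base_certificate c1 c2 c3 w1 w2 w3 b1 b2 b3 a b c :
  jointly_adjacent c1 c2 c3 w1 w2 w3 ->
  load_bound c1 w1 b1 -> load_bound c2 w2 b2 -> load_bound c3 w3 b3 ->
  (forall v, v \in S -> [&& c1 v == a, c2 v == b & c3 v == c] \/
     2 <= at_label c1 w1 a v + at_label c2 w2 b v + at_label c3 w3 c v) ->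
  2 * #|S| <= b1 + b2 + b3 + maxn b1 (maxn b2 b3).
Proof.
move=> H B1 B2 B3 D; rewrite /at_label in D.
case: (ex_or_all (fun v => [&& c1 v == a, c2 v == b & c3 v == c] &&
  [&& w1 v == 1, w2 v == 0 & w3 v == 0])) => [[x xS hx]|no1].
  have := @weight_certificate (at_label c1 w1 a) (at_label c1 w1 a)
    (at_label c2 w2 b) (at_label c3 w3 c) b1 b1 b2 b3 (B1 a) (B1 a) (B2 b) (B3 c).
  suff h : forall v, v \in S -> 2 <= at_label c1 w1 a v + at_label c1 w1 a v
      + at_label c2 w2 b v + at_label c3 w3 c v by move=> /(_ h); lia.
  move=> v vS; rewrite /at_label; have := D v vS; have := H v x vS xS.
  have := H v v vS vS; eqlia.
case: (ex_or_all (fun v => [&& c1 v == a, c2 v == b & c3 v == c] &&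
  [&& w1 v == 0, w2 v == 1 & w3 v == 0])) => [[x xS hx]|no2].
  have := @weight_certificate (at_label c1 w1 a) (at_label c2 w2 b)
    (at_label c2 w2 b) (at_label c3 w3 c) b1 b2 b2 b3 (B1 a) (B2 b) (B2 b) (B3 c).
  suff h : forall v, v \in S -> 2 <= at_label c1 w1 a v + at_label c2 w2 b v
      + at_label c2 w2 b v + at_label c3 w3 c v by move=> /(_ h); lia.
  move=> v vS; rewrite /at_label; have := D v vS; have := H v x vS xS.
  have := H v v vS vS; eqlia.
have := @weight_certificate (at_label c1 w1 a) (at_label c2 w2 b)
    (at_label c3 w3 c) (at_label c3 w3 c) b1 b2 b3 b3 (B1 a) (B2 b) (B3 c) (B3 c).
suff h : forall v, v \in S -> 2 <= at_label c1 w1 a v + at_label c2 w2 b v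
      + at_label c3 w3 c v + at_label c3 w3 c v by move=> /(_ h); lia.
move=> v vS; rewrite /at_label; have := D v vS; have := no1 v vS; have := no2 v vS.
have := H v v vS vS; eqlia.
Qed.

Lemma majority_extremal c1 c2 c3 w1 w2 w3 b1 b2 b3 a b c :
  jointly_adjacent c1 c2 c3 w1 w2 w3 ->
  load_bound c1 w1 b1 -> load_bound c2 w2 b2 -> load_bound c3 w3 b3 ->
  agree_twice c1 c2 c3 a b c ->
  2 * #|S| <= b1 + b2 + b3 + maxn b1 (maxn b2 b3).
Proof.
move=> H B1 B2 B3 D.
case: (ex_or_all (fun v => (c1 v != a) && (w2 v + w3 v <= 1))) => [[x xS /andP[h h']]|no1].
  exact: (majority_deficient H B1 B2 B3 D xS h h').
case: (ex_or_all (fun v => (c2 v != b) && (w1 v + w3 v <= 1))) => [[x xS /andP[h h']]|no2].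
  have D' : agree_twice c2 c1 c3 b a c by move=> v /D; eqlia.
  have := majority_deficient (jointly_adjacent_swap12 H) B2 B1 B3 D' xS h h'; lia.
case: (ex_or_all (fun v => (c3 v != c) && (w1 v + w2 v <= 1))) => [[x xS /andP[h h']]|no3].
  have D' : agree_twice c3 c1 c2 c a b by move=> v /D; eqlia.
  have := majority_deficient (jointly_adjacent_swap12 (jointly_adjacent_swap23 H))
    B3 B1 B2 D' xS h h'; lia.
apply: (base_certificate (a := a) (b := b) (c := c) H B1 B2 B3) => v vS.
have := D v vS; have := no1 v vS; have := no2 v vS; have := no3 v vS.
rewrite /at_label; eqlia.
Qed.

(** Any two of the four triples agree in exactly one colour: reading primes as ones, they are the
    words of even weight of length 3. *)
Definition four_parts (c1 c2 c3 : V -> nat) (a a' b b' c c' : nat) :=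
  [/\ a != a', b != b', c != c' & forall v, v \in S ->
  [|| [&& c1 v == a, c2 v == b & c3 v == c], [&& c1 v == a, c2 v == b' & c3 v == c'],
      [&& c1 v == a', c2 v == b & c3 v == c'] | [&& c1 v == a', c2 v == b' & c3 v == c]]].

Definition part_size (c1 c2 c3 : V -> nat) (a b c : nat) :=
  \sum_(v in S) ([&& c1 v == a, c2 v == b & c3 v == c] : nat).

Lemma min_weight (P : pred V) (w : V -> nat) v0 : v0 \in S -> P v0 ->
  exists2 x, x \in S /\ P x & forall v, v \in S -> P v -> w x <= w v.
Proof.
move=> v0S Pv0.
have v0SP : (v0 \in S) && P v0 by rewrite v0S.
case: (@arg_minnP _ v0 (fun v => (v \in S) && P v) w v0SP) => x /andP[xS Px] h.
by exists x => // v vS Pv; apply: h; rewrite vS.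
Qed.

(** Let [p2], [p3] be the least weights on the part [(a, b, c)] in colours 2 and 3. Joint adjacency
    forces weight [2 - p2] in colour 2 on [(a', b, c')] and [2 - p3] in colour 3 on [(a', b', c)].
    The missing [p2] and [p3] per vertex are supplied by [(a, b, c)], which is at least as large as
    either part. *)
Lemma four_parts_heavy c1 c2 c3 w1 w2 w3 b1 b2 b3 a a' b b' c c' v0 :
  jointly_adjacent c1 c2 c3 w1 w2 w3 ->
  load_bound c1 w1 b1 -> load_bound c2 w2 b2 -> load_bound c3 w3 b3 ->
  four_parts c1 c2 c3 a a' b b' c c' ->
  part_size c1 c2 c3 a b' c' <= part_size c1 c2 c3 a b c ->
  part_size c1 c2 c3 a' b c' <= part_size c1 c2 c3 a b c ->
  part_size c1 c2 c3 a' b' c <= part_size c1 c2 c3 a b c ->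
  v0 \in S -> [&& c1 v0 == a, c2 v0 == b & c3 v0 == c] ->
  (forall v, v \in S -> [&& c1 v == a, c2 v == b & c3 v == c] -> 1 <= w1 v) ->
  2 * #|S| <= b1 + b2 + b3 + maxn b1 (maxn b2 b3).
Proof.
move=> H B1 B2 B3 [aa bb cc D].
set x1 := part_size c1 c2 c3 a b c; set x2 := part_size c1 c2 c3 a b' c'.
set x3 := part_size c1 c2 c3 a' b c'; set x4 := part_size c1 c2 c3 a' b' c.
move=> h2 h3 h4 v0S v0P w1pos.
pose inP v := [&& c1 v == a, c2 v == b & c3 v == c].
have [z1 [z1S z1P] m1] := @min_weight inP w1 v0 v0S v0P.
have [z2 [z2S z2P] m2] := @min_weight inP w2 v0 v0S v0P.
have [z3 [z3S z3P] m3] := @min_weight inP w3 v0 v0S v0P.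
have lower (g f : V -> nat) k1 k2 k3 k4 :
    (forall v, v \in S -> f v = [&& c1 v == a, c2 v == b & c3 v == c] * k1
      + [&& c1 v == a, c2 v == b' & c3 v == c'] * k2
      + [&& c1 v == a', c2 v == b & c3 v == c'] * k3
      + [&& c1 v == a', c2 v == b' & c3 v == c] * k4) ->
    (forall v, v \in S -> f v <= g v) ->
    x1 * k1 + x2 * k2 + x3 * k3 + x4 * k4 <= \sum_(v in S) g v.
  move=> hf hg; rewrite /x1 /x2 /x3 /x4 /part_size !big_distrl -!big_split /=.
  by apply: leq_sum => v vS; rewrite -hf // hg.
have w11 : 1 <= w1 z1 by exact: w1pos.
have adj z v : z \in S -> v \in S -> [&& c1 z == a, c2 z == b & c3 z == c] ->
    [|| (c1 v == a) && (2 <= w1 v + w1 z), (c2 v == b) && (2 <= w2 v + w2 z)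
      | (c3 v == c) && (2 <= w3 v + w3 z)].
  by move=> zS vS /and3P[/eqP<- /eqP<- /eqP<-]; apply: H.
have a1z1 := adj z1 _ z1S _ z1P; have a1z2 := adj z2 _ z2S _ z2P.
have a1z3 := adj z3 _ z3S _ z3P.
move: aa bb cc; rewrite eq_sym => /negbTE aa; rewrite eq_sym => /negbTE bb.
rewrite eq_sym => /negbTE cc.
have simp := (eqxx, aa, bb, cc, eq_sym a a', eq_sym b b', eq_sym c c', mul1n, mul0n,
  addn0, add0n, orbF).
have sizeS : #|S| = x1 + x2 + x3 + x4.
  rewrite /x1 /x2 /x3 /x4 /part_size -!big_split -sum1_card /=.
  apply: eq_bigr => v vS.
  by case/or4P: (D v vS) => /and3P[/eqP-> /eqP-> /eqP->]; rewrite !simp.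
set p2 := w2 z2 in m2 a1z2; set p3 := w3 z3 in m3 a1z3.
have parts (f g : V -> nat) : (forall v, v \in S ->
    [/\ p2 <= w2 v, p3 <= w3 v & w1 z1 <= w1 v] -> c1 v = a -> c2 v = b -> c3 v = c -> f v <= g v) ->
  (forall v, v \in S -> 2 <= w1 v + w1 z1 -> c1 v = a -> c2 v = b' -> c3 v = c' -> f v <= g v) ->
  (forall v, v \in S -> 2 <= w2 v + p2 -> c1 v = a' -> c2 v = b -> c3 v = c' -> f v <= g v) ->
  (forall v, v \in S -> 2 <= w3 v + p3 -> c1 v = a' -> c2 v = b' -> c3 v = c -> f v <= g v) ->
  forall v, v \in S -> f v <= g v.
  move=> q1 q2 q3 q4 v vS.
  case/or4P: (D v vS) => /and3P[/eqP e1 /eqP e2 /eqP e3].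
  - apply: q1 => //; split; [apply: m2|apply: m3|apply: m1] => //; by rewrite /inP e1 e2 e3 !eqxx.
  - by apply: q2 => //; have := a1z1 v vS; rewrite e1 e2 e3 !simp.
  - by apply: q3 => //; have := a1z2 v vS; rewrite e1 e2 e3 !simp.
  by apply: q4 => //; have := a1z3 v vS; rewrite e1 e2 e3 !simp.
have g3 : x3 * p2 <= x1 * p2 by rewrite leq_mul2r h3 orbT.
have g4 : x4 * p3 <= x1 * p3 by rewrite leq_mul2r h4 orbT.
have t3 : 2 * x3 <= x3 * (2 - p2) + x3 * p2 by nia.
have t4 : 2 * x4 <= x4 * (2 - p3) + x4 * p3 by nia.
(* If the weight in colour 1 is at least 2 throughout [(a, b, c)], the second copy of the largest
   load pays for all of [(a, b', c')], which is no larger. *)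
rewrite sizeS; have [hp1|hp1] := leqP 2 (w1 z1).
  have K1 : x1 * 2 + x2 * 0 + x3 * 0 + x4 * 0 <= b1.
    apply: leq_trans (B1 a); apply: lower => [v vS|]; first by [].
    by apply: parts => v vS h e1 e2 e3; rewrite /at_label /= e1 e2 e3 !simp //; case: h; lia.
  have K2 : x1 * (2 + p2 + p3) + x2 * 0 + x3 * (2 - p2) + x4 * (2 - p3) <= b1 + b2 + b3.
    apply: leq_trans (leq_add (leq_add (B1 a) (B2 b)) (B3 c)); rewrite -!big_split /=.
    apply: lower => [v vS|]; first by [].
    by apply: parts => v vS h e1 e2 e3; rewrite /at_label /= e1 e2 e3 !simp; try case: h; lia.
  rewrite !mulnDr in K1 K2 *; lia.
(* A vertex of weight 1 forces weight at least 1 in colour 1 on [(a, b', c')], so counting label [a]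
   twice gives 2 on both parts. *)
have w1eq : w1 z1 = 1 by lia.
have K2 : x1 * (2 + p2 + p3) + x2 * 2 + x3 * (2 - p2) + x4 * (2 - p3) <= b1 + b1 + b2 + b3.
  apply: leq_trans (leq_add (leq_add (leq_add (B1 a) (B1 a)) (B2 b)) (B3 c)).
  rewrite -!big_split /=; apply: lower => [v vS|]; first by [].
  by apply: parts => v vS h e1 e2 e3; rewrite /at_label /= e1 e2 e3 !simp; try case: h; lia.
rewrite !mulnDr in K2 *; lia.
Qed.
End Extremal.

(** * Classification of the label triples *)

Section Classification.
Variables (V : finType) (S : {set V}).

(** If in each colour some vertex of [(a, b, c)] has weight 0, then each other part, which shares
    only one label with it, has weight at least 2 in that colour and [base_certificate] applies.
    Otherwise some colour is positive on all of [(a, b, c)], the case of [four_parts_heavy]. *)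
Lemma four_parts_largest c1 c2 c3 w1 w2 w3 b1 b2 b3 a a' b b' c c' :
  jointly_adjacent S c1 c2 c3 w1 w2 w3 ->
  load_bound S c1 w1 b1 -> load_bound S c2 w2 b2 -> load_bound S c3 w3 b3 ->
  four_parts S c1 c2 c3 a a' b b' c c' ->
  part_size S c1 c2 c3 a b' c' <= part_size S c1 c2 c3 a b c ->
  part_size S c1 c2 c3 a' b c' <= part_size S c1 c2 c3 a b c ->
  part_size S c1 c2 c3 a' b' c <= part_size S c1 c2 c3 a b c ->
  2 * #|S| <= b1 + b2 + b3 + maxn b1 (maxn b2 b3).
Proof.
move=> H B1 B2 B3 F h2 h3 h4.
pose P v := [&& c1 v == a, c2 v == b & c3 v == c].
case: (ex_or_all S (fun v => P v)) => [[v0 v0S v0P]|no0]; last first.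
  have x1 : part_size S c1 c2 c3 a b c = 0.
    by rewrite /part_size big1 // => v /no0; rewrite /P; lia.
  have : #|S| = 0; last by lia.
  case: F => _ _ _ D; rewrite x1 in h2 h3 h4.
  have : #|S| <= part_size S c1 c2 c3 a b c + part_size S c1 c2 c3 a b' c'
     + part_size S c1 c2 c3 a' b c' + part_size S c1 c2 c3 a' b' c.
    rewrite /part_size -!big_split -sum1_card /=.
    by apply: leq_sum => v vS; have := D v vS; lia.
  lia.
have sz : forall a b c, part_size S c2 c1 c3 b a c = part_size S c1 c2 c3 a b c.
  by move=> *; apply: eq_bigr => v _; lia.
have sz3 : forall a b c, part_size S c3 c1 c2 c a b = part_size S c1 c2 c3 a b c.
  by move=> *; apply: eq_bigr => v _; lia.
case: (ex_or_all S (fun v => P v && (w1 v == 0))) => [[y1 y1S /andP[/and3P[/eqP y1a /eqP y1b /eqP y1c] /eqP y1w]]|no1]; last first.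
  apply: (four_parts_heavy H B1 B2 B3 F h2 h3 h4 v0S v0P) => v /no1.
  by rewrite /P; lia.
case: (ex_or_all S (fun v => P v && (w2 v == 0))) => [[y2 y2S /andP[/and3P[/eqP y2a /eqP y2b /eqP y2c] /eqP y2w]]|no2]; last first.
  have F' : four_parts S c2 c1 c3 b b' a a' c c'.
    case: F => aa bb cc D; split=> // v vS.
    by case/or4P: (D v vS) => /and3P[-> -> ->]; rewrite /= ?orbT.
  have := four_parts_heavy (jointly_adjacent_swap12 H) B2 B1 B3 F'.
  rewrite !sz => /(_ v0 h3 h2 h4 v0S).
  move: v0P no2; rewrite /P => v0P no2 h.
  have : 2 * #|S| <= b2 + b1 + b3 + maxn b2 (maxn b1 b3); last by lia.
  by apply: h => [|v /no2]; lia.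
case: (ex_or_all S (fun v => P v && (w3 v == 0))) => [[y3 y3S /andP[/and3P[/eqP y3a /eqP y3b /eqP y3c] /eqP y3w]]|no3]; last first.
  have F' : four_parts S c3 c1 c2 c c' a a' b b'.
    case: F => aa bb cc D; split=> // v vS.
    by case/or4P: (D v vS) => /and3P[-> -> ->]; rewrite /= ?orbT.
  have := four_parts_heavy (jointly_adjacent_swap12 (jointly_adjacent_swap23 H))
    B3 B1 B2 F'.
  rewrite !sz3 => /(_ v0 h4 h2 h3 v0S).
  move: v0P no3; rewrite /P => v0P no3 h.
  have : 2 * #|S| <= b3 + b1 + b2 + maxn b3 (maxn b1 b2); last by lia.
  by apply: h => [|v /no3]; lia.
apply: (base_certificate H B1 B2 B3 (a := a) (b := b) (c := c)) => v vS.
case: F => aa bb cc D.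
have {}hy1 := H v y1 vS y1S; have {}hy2 := H v y2 vS y2S; have {}hy3 := H v y3 vS y3S.
move: aa bb cc; rewrite eq_sym => /negbTE aa; rewrite eq_sym => /negbTE bb.
rewrite eq_sym => /negbTE cc.
have simp := (eqxx, aa, bb, cc, mul1n, mul0n, addn0, add0n, orbF, andbF).
case/or4P: (D v vS) => /and3P[/eqP e1 /eqP e2 /eqP e3].
- by left; rewrite e1 e2 e3 !eqxx.
- by right; move: hy1; rewrite /at_label e1 e2 e3 y1a y1b y1c y1w !simp; lia.
- by right; move: hy2; rewrite /at_label e1 e2 e3 y2a y2b y2c y2w !simp; lia.
by right; move: hy3; rewrite /at_label e1 e2 e3 y3a y3b y3c y3w !simp; lia.
Qed.

Lemma four_parts_extremal c1 c2 c3 w1 w2 w3 b1 b2 b3 a a' b b' c c' :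
  jointly_adjacent S c1 c2 c3 w1 w2 w3 ->
  load_bound S c1 w1 b1 -> load_bound S c2 w2 b2 -> load_bound S c3 w3 b3 ->
  four_parts S c1 c2 c3 a a' b b' c c' ->
  2 * #|S| <= b1 + b2 + b3 + maxn b1 (maxn b2 b3).
Proof.
move=> H B1 B2 B3 F.
have F2 : four_parts S c1 c2 c3 a a' b' b c' c.
  case: F => aa bb cc D; split=> [|||v vS] //; try by rewrite eq_sym.
  by case/or4P: (D v vS) => /and3P[-> -> ->]; rewrite /= ?orbT.
have F3 : four_parts S c1 c2 c3 a' a b b' c' c.
  case: F => aa bb cc D; split=> [|||v vS] //; try by rewrite eq_sym.
  by case/or4P: (D v vS) => /and3P[-> -> ->]; rewrite /= ?orbT.
have F4 : four_parts S c1 c2 c3 a' a b' b c c'.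
  case: F => aa bb cc D; split=> [|||v vS] //; try by rewrite eq_sym.
  by case/or4P: (D v vS) => /and3P[-> -> ->]; rewrite /= ?orbT.
have := four_parts_largest H B1 B2 B3 F; have := four_parts_largest H B1 B2 B3 F2.
have := four_parts_largest H B1 B2 B3 F3; have := four_parts_largest H B1 B2 B3 F4.
set x1 := part_size S c1 c2 c3 a b c; set x2 := part_size S c1 c2 c3 a b' c'.
set x3 := part_size S c1 c2 c3 a' b c'; set x4 := part_size S c1 c2 c3 a' b' c.
move=> k4 k3 k2 k1.
have [g12|/ltnW g12] := leqP x2 x1; have [g34|/ltnW g34] := leqP x4 x3.
- have [g|/ltnW g] := leqP x3 x1.
    by apply: k1 => //; apply: leq_trans g34 g.
  by apply: k3 => //; apply: leq_trans g12 g.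
- have [g|/ltnW g] := leqP x4 x1.
    by apply: k1 => //; apply: leq_trans g34 g.
  by apply: k4 => //; apply: leq_trans g12 g.
- have [g|/ltnW g] := leqP x3 x2.
    by apply: k2 => //; apply: leq_trans g34 g.
  by apply: k3 => //; apply: leq_trans g12 g.
have [g|/ltnW g] := leqP x4 x2.
  by apply: k2 => //; apply: leq_trans g34 g.
by apply: k4 => //; apply: leq_trans g12 g.
Qed.

Lemma four_types_bool (A A' B B' C C' : bool) :
  ~~ (A && A') -> ~~ (B && B') -> ~~ (C && C') ->
  [|| A, B | C] -> [|| A, B' | C'] -> [|| A', B | C'] -> [|| A', B' | C] ->
  [|| [&& A, B & C], [&& A, B' & C'], [&& A', B & C'] | [&& A', B' & C]].
Proof. by case: A; case: A'; case: B; case: B'; case: C; case: C'. Qed.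

Lemma two_of_three_bool (A A' B B' C C' : bool) :
  ~~ (A && A') -> ~~ (B && B') -> ~~ (C && C') ->
  [|| A, B | C] -> [|| A, B' | C'] -> [|| A', B | C'] -> ~~ [&& A', B' & C] ->
  2 <= A + B + C'.
Proof. by case: A; case: A'; case: B; case: B'; case: C; case: C'. Qed.

Lemma labels_agree c1 c2 c3 w1 w2 w3 u v :
  jointly_adjacent S c1 c2 c3 w1 w2 w3 -> u \in S -> v \in S ->
  [|| c1 u == c1 v, c2 u == c2 v | c3 u == c3 v].
Proof.
by move=> H uS vS; case/or3P: (H u v uS vS) => /andP[-> _]; rewrite ?orbT.
Qed.

(** A vertex [z] off the common label in colour 1 must take one of its other labels from [x] and the
    other from [y]. These three triples lie in a pattern of four: if the fourth occurs, there are
    exactly these four parts; if not, every triple agrees twice with a fixed one. *)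
Lemma single_agreement_extremal c1 c2 c3 w1 w2 w3 b1 b2 b3 x y :
  jointly_adjacent S c1 c2 c3 w1 w2 w3 ->
  load_bound S c1 w1 b1 -> load_bound S c2 w2 b2 -> load_bound S c3 w3 b3 ->
  x \in S -> y \in S -> c1 x = c1 y -> c2 x <> c2 y -> c3 x <> c3 y ->
  2 * #|S| <= b1 + b2 + b3 + maxn b1 (maxn b2 b3).
Proof.
move=> H B1 B2 B3.
have sub x' y' z : x' \in S -> y' \in S -> z \in S -> c1 x' = c1 y' ->
    c2 x' <> c2 y' -> c3 x' <> c3 y' -> c1 z <> c1 x' -> c2 z = c2 x' -> c3 z = c3 y' ->
    2 * #|S| <= b1 + b2 + b3 + maxn b1 (maxn b2 b3).
  move=> xS yS zS e1 n2 n3 ne ez2 ez3.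
  have A1 v : v \in S -> _ := fun vS => labels_agree H vS xS.
  have A2 v : v \in S -> _ := fun vS => labels_agree H vS yS.
  have A3 v : v \in S -> _ := fun vS => labels_agree H vS zS.
  rewrite -e1 ez2 ez3 in A1 A2 A3.
  have d1 v : ~~ ((c1 v == c1 x') && (c1 v == c1 z)) by lia.
  have d2 v : ~~ ((c2 v == c2 x') && (c2 v == c2 y')) by lia.
  have d3 v : ~~ ((c3 v == c3 x') && (c3 v == c3 y')) by lia.
  case: (ex_or_all S (fun v => [&& c1 v == c1 z, c2 v == c2 y' & c3 v == c3 x']))
    => [[p pS /and3P[/eqP p1 /eqP p2 /eqP p3]]|nop].
    apply: (four_parts_extremal H B1 B2 B3 (a := c1 x') (a' := c1 z) (b := c2 x')
      (b' := c2 y') (c := c3 x') (c' := c3 y')).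
    split=> [|||v vS]; [lia..|].
    have A4 := labels_agree H vS pS; rewrite p1 p2 p3 in A4.
    exact: four_types_bool (d1 v) (d2 v) (d3 v) (A1 v vS) (A2 v vS) (A3 v vS) A4.
  apply: (majority_extremal H B1 B2 B3 (a := c1 x') (b := c2 x') (c := c3 y')) => v vS.
  exact: two_of_three_bool (d1 v) (d2 v) (d3 v) (A1 v vS) (A2 v vS) (A3 v vS) (nop v vS).
move=> xS yS e1 n2 n3.
case: (ex_or_all S (fun v => c1 v != c1 x)) => [[z zS hz]|star]; last first.
  by apply: (star_extremal H B1 B2 B3 (a := c1 x)) => v /star; lia.
have [/andP[/eqP h2 /eqP h3]|h] := boolP ((c2 z == c2 x) && (c3 z == c3 y)).
  by apply: (sub x y z) => //; lia.
have := labels_agree H zS xS; have := labels_agree H zS yS => g1 g2.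
by apply: (sub y x z) => //; lia.
Qed.

(** Unless colour 1 or colour 2 has a single label, some two vertices agree in exactly one colour:
    if one vertex leaves [x] only in colour 1 and another only in colour 2, they agree with each
    other only in colour 3. *)
Theorem jointly_adjacent_extremal c1 c2 c3 w1 w2 w3 b1 b2 b3 :
  jointly_adjacent S c1 c2 c3 w1 w2 w3 ->
  load_bound S c1 w1 b1 -> load_bound S c2 w2 b2 -> load_bound S c3 w3 b3 ->
  2 * #|S| <= b1 + b2 + b3 + maxn b1 (maxn b2 b3).
Proof.
move=> H B1 B2 B3.
have E1 := single_agreement_extremal H B1 B2 B3.
have E2 := single_agreement_extremal (jointly_adjacent_swap12 H) B2 B1 B3.
have E3 := single_agreement_extremal
  (jointly_adjacent_swap12 (jointly_adjacent_swap23 H)) B3 B1 B2.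
have {}E2 x y (xS : x \in S) (yS : y \in S) : c2 x = c2 y -> c1 x <> c1 y -> c3 x <> c3 y ->
    2 * #|S| <= b1 + b2 + b3 + maxn b1 (maxn b2 b3).
  by move=> h1 h2 h3; have := E2 x y xS yS h1 h2 h3; lia.
have {}E3 x y (xS : x \in S) (yS : y \in S) : c3 x = c3 y -> c1 x <> c1 y -> c2 x <> c2 y ->
    2 * #|S| <= b1 + b2 + b3 + maxn b1 (maxn b2 b3).
  by move=> h1 h2 h3; have := E3 x y xS yS h1 h2 h3; lia.
case: (set_0Vmem S) => [->|[x xS]]; first by rewrite cards0.
case: (ex_or_all S (fun v => c1 v != c1 x)) => [[v1 v1S n1]|star]; last first.
  by apply: (star_extremal H B1 B2 B3 (a := c1 x)) => v /star; lia.
case: (ex_or_all S (fun v => c2 v != c2 x)) => [[v2 v2S n2]|star]; last first.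
  have := star_extremal (jointly_adjacent_swap12 H) B2 B1 B3 (a := c2 x).
  suff g : forall v, v \in S -> c2 v = c2 x by move=> /(_ g); lia.
  by move=> v /star; lia.
have [/eqP e12|n12] := boolP (c2 v1 == c2 x); last first.
  have [/eqP e13|n13] := boolP (c3 v1 == c3 x); first by apply: (E3 x v1 xS v1S); lia.
  by have := labels_agree H v1S xS; lia.
have [/eqP e13|n13] := boolP (c3 v1 == c3 x); last by apply: (E2 x v1 xS v1S); lia.
have [/eqP e21|n21] := boolP (c1 v2 == c1 x); last first.
  by apply: (E3 x v2 xS v2S); have := labels_agree H v2S xS; lia.
have [/eqP e23|n23] := boolP (c3 v2 == c3 x); last by apply: (E1 x v2 xS v2S); lia.
by apply: (E3 v1 v2 v1S v2S); lia.
Qed.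
End Classification.

(** * Matchings and covers *)

Definition matching (T U : finType) (M : {set T * U}) :=
  forall p q, p \in M -> q \in M -> (p.1 == q.1) || (p.2 == q.2) -> p = q.

Definition covers (T U : finType) (X : {set T}) (Y : {set U}) (E : {set T * U}) :=
  forall p, p \in E -> (p.1 \in X) || (p.2 \in Y).

(* Uncrossing: the covers [(X1 & X2, Y1 | Y2)] and [(X1 | X2, Y1 & Y2)] have the
   same total size as the given ones. *)
Lemma koenig_uncross (T U : finType) (E : {set T * U}) p q (X1 X2 : {set T})
    (Y1 Y2 : {set U}) (k : nat) :
  p \in E -> q \in E -> p.1 = q.1 -> p != q ->
  covers X1 Y1 (E :\ p) -> covers X2 Y2 (E :\ q) ->
  ~~ ((p.1 \in X1) || (p.2 \in Y1)) -> ~~ ((q.1 \in X2) || (q.2 \in Y2)) ->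
  #|X1| + #|Y1| <= k -> #|X2| + #|Y2| <= k ->
  exists X Y, covers X Y E /\ #|X| + #|Y| <= k.
Proof.
move=> pE qE e pq C1 C2 n1 n2 k1 k2.
have := cardsUI X1 X2; have := cardsUI Y1 Y2 => sY sX.
have cA : covers (X1 :&: X2) (Y1 :|: Y2) E.
  move=> r rE; rewrite !inE.
  have [rp|rp] := eqVneq r p.
    have : p \in E :\ q by rewrite !inE pq.
    by rewrite rp => /C2; move: n1 n2; rewrite e; do 4!case: (_ \in _).
  have [rq|rq] := eqVneq r q.
    have : q \in E :\ p by rewrite !inE eq_sym pq.
    by rewrite rq => /C1; move: n1 n2; rewrite e; do 5!case: (_ \in _).
  have : r \in E :\ p by rewrite !inE rp.
  have : r \in E :\ q by rewrite !inE rq.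
  by move=> /C2 + /C1; do 4!case: (_ \in _).
have cB : covers (p.1 |: (X1 :|: X2)) (Y1 :&: Y2) E.
  move=> r rE; rewrite !inE.
  have [rp|rp] := eqVneq r p; first by rewrite rp eqxx.
  have [rq|rq] := eqVneq r q; first by rewrite rq e eqxx.
  have : r \in E :\ p by rewrite !inE rp.
  have : r \in E :\ q by rewrite !inE rq.
  by move=> /C2 + /C1; case: (_ == _); do 4!case: (_ \in _).
have sB : #|p.1 |: (X1 :|: X2)| <= (#|X1 :|: X2|).+1 by rewrite cardsU1; lia.
(* The two candidates have total size at most [2 * k + 1], the extra 1 being the shared endpoint
   [p.1]; hence one has size at most [k]. *)
have [h|h] := leqP (#|X1 :&: X2| + #|Y1 :|: Y2|) k.
  by exists (X1 :&: X2), (Y1 :|: Y2).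
exists (p.1 |: (X1 :|: X2)), (Y1 :&: Y2); split=> //; lia.
Qed.

(** Induction on the number of edges. If no two edges meet, [E] is a matching. Otherwise two meeting
    edges are deleted in turn; if neither resulting cover catches its missing edge, the two covers
    are uncrossed, and the larger of the two matchings serves. *)
Lemma koenig (T U : finType) (E : {set T * U}) :
  exists (M : {set T * U}) (X : {set T}) (Y : {set U}),
    [/\ M \subset E, matching M, covers X Y E & #|X| + #|Y| <= #|M|].
Proof.
have [n] := ubnP #|E|; elim: n => // n IH in E *; rewrite ltnS => En.
have [/existsP[p /existsP[q /and4P[pE qE pq h]]]|] :=
  boolP [exists p, exists q, [&& p \in E, q \in E, p != q & (p.1 == q.1) || (p.2 == q.2)]];
  last first.
  move=> /existsPn h; exists E, [set p.1 | p in E], finset.set0; split=> //.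
  - move=> p q pE qE pq; apply/eqP; apply: contraT => npq.
    by have /existsPn /(_ q) := h p; rewrite pE qE npq pq.
  - by move=> p pE; rewrite imset_f.
  by rewrite cards0 addn0 leq_imset_card.
have sub r : r \in E -> #|E :\ r| < n by move=> rE; rewrite (cardsD1 r E) rE in En; lia.
have [M1 [X1 [Y1 [s1 m1 c1 k1]]]] := IH _ (sub p pE).
have [M2 [X2 [Y2 [s2 m2 c2 k2]]]] := IH _ (sub q qE).
have t1 : M1 \subset E by apply: fintype.subset_trans s1 (finset.subsetDl _ _).
have t2 : M2 \subset E by apply: fintype.subset_trans s2 (finset.subsetDl _ _).
have [n1|n1] := boolP ((p.1 \in X1) || (p.2 \in Y1)).
  exists M1, X1, Y1; split=> // r rE; have [->//|rp] := eqVneq r p.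
  by apply: c1; rewrite !inE rp.
have [n2|n2] := boolP ((q.1 \in X2) || (q.2 \in Y2)).
  exists M2, X2, Y2; split=> // r rE; have [->//|rp] := eqVneq r q.
  by apply: c2; rewrite !inE rp.
have [M [sM mM kM1 kM2]] : exists M : {set T * U},
    [/\ M \subset E, matching M, #|M1| <= #|M| & #|M2| <= #|M|].
  by have [h'|/ltnW h'] := leqP #|M1| #|M2|; [exists M2|exists M1].
have K1 : #|X1| + #|Y1| <= #|M| by apply: leq_trans k1 kM1.
have K2 : #|X2| + #|Y2| <= #|M| by apply: leq_trans k2 kM2.
suff [X [Y [cXY kXY]]] : exists X Y, covers X Y E /\ #|X| + #|Y| <= #|M|.
  by exists M, X, Y.
case/orP: h => /eqP h; first exact: koenig_uncross pE qE h pq c1 c2 n1 n2 K1 K2.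
(* The edges meet in their second coordinate, so the uncrossing is applied to the transposed
   graph. *)
pose E' : {set U * T} := [set (z.2, z.1) | z in E].
have memE' z : ((z.2, z.1) \in E') = (z \in E).
  apply/imsetP/idP => [[[a b] abE]|zE]; last by exists z.
  by case: z => [c d] /= [-> ->].
have cov' X Y z : covers X Y (E :\ z) -> covers Y X (E' :\ (z.2, z.1)).
  move=> c [b a] /=; rewrite !inE xpair_eqE => /andP[nz zE'].
  have abE : (a, b) \in E by rewrite -memE'.
  rewrite orbC; apply: (c (a, b)); rewrite !inE abE andbT.
  by apply: contraNneq nz => <- /=; rewrite !eqxx.
have [||||||||||X [Y [cXY kXY]]] := @koenig_uncross U T E' (p.2, p.1) (q.2, q.1) Y1 Y2 X1 X2 #|M|.
- by rewrite memE'.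
- by rewrite memE'.
- by [].
- apply: contraNneq pq => -[e2 e1]; apply/eqP.
  by case: (p) (q) e1 e2 => [? ?] [? ?] /= -> ->.
- exact: cov'.
- exact: cov'.
- by rewrite orbC.
- by rewrite orbC.
- by rewrite addnC.
- by rewrite addnC.
exists Y, X; split; last by rewrite addnC.
by move=> z zE; rewrite orbC; apply: (cXY (z.2, z.1)); rewrite memE'.
Qed.

(** * Lower regularity *)

Definition cell (V A : finType) (P : V -> A) (a : A) : {set V} := [set v | P v == a].

Definition ecount (V : finType) (H : rel V) (X Y : {set V}) : nat :=
  \sum_(x in X) \sum_(y in Y) (H x y : nat).

Lemma ecount_mono (V : finType) (H : rel V) (X X' Y Y' : {set V}) :
  X \subset X' -> Y \subset Y' -> ecount H X Y <= ecount H X' Y'.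
Proof.
move=> sX sY; rewrite /ecount [leqRHS](big_setID X) /=.
rewrite (finset.setIidPr sX); apply: leq_trans (leq_addr _ _).
apply: leq_sum => x _; rewrite [leqRHS](big_setID Y) /= (finset.setIidPr sY).
exact: leq_addr.
Qed.

Lemma ecount_le (V : finType) (H : rel V) (X Y : {set V}) : ecount H X Y <= #|X| * #|Y|.
Proof.
rewrite /ecount -sum_nat_const; apply: leq_sum => x _; rewrite -sum1_card.
by apply: leq_sum => y _; case: (H x y).
Qed.

Lemma exists_subset_card (V : finType) (S : {set V}) n :
  n <= #|S| -> exists2 B : {set V}, B \subset S & #|B| = n.
Proof.
move=> nS; exists [set x in take n (enum S)].
  by apply/fintype.subsetP => x; rewrite inE => /mem_take; rewrite mem_enum.
rewrite cardsE (card_uniqP _); last by rewrite take_uniq ?enum_uniq.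
by rewrite size_takel // -cardE.
Qed.

Lemma chop (V G : finType) (g : V -> G) (l r : nat) (S : {set V}) : #|S| = r * l ->
  exists h : V -> nat, [/\ forall v, v \in S -> h v < r,
    forall i, i < r -> #|[set v in S | h v == i]| = l
  & forall x, #|[set v in S | (g v == x) && [exists u in S, (h u == h v) && (g u != x)]]| <= l].
Proof.
elim: r S => [|r IH] S cS.
  move: cS => /eqP; rewrite cards_eq0 => /eqP ->.
  exists (fun _ => 0); split=> // [v|x]; first by rewrite inE.
  by rewrite (_ : [set _ in _ | _] = finset.set0) ?cards0 //; apply/setP=> v; rewrite !inE.
have [B [sB cB gB]] : exists B : {set V}, [/\ B \subset S, #|B| = l &
   (forall u v, u \in B -> v \in B -> g u = g v) \/
   (forall x, #|[set v in S | g v == x]| <= l)].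
  have [/existsP[x hx]|/existsPn h] := boolP [exists x, l <= #|[set v in S | g v == x]|].
    have [B sB cB] := exists_subset_card hx.
    exists B; split=> //.
      by apply: (fintype.subset_trans sB); apply/fintype.subsetP => v; rewrite inE => /andP[].
    left=> u v uB vB; have := fintype.subsetP sB _ uB; have := fintype.subsetP sB _ vB.
    by rewrite !inE => /andP[_ /eqP->] /andP[_ /eqP->].
  have [B sB cB] : exists2 B : {set V}, B \subset S & #|B| = l.
    by apply: exists_subset_card; rewrite cS mulSn leq_addr.
  by exists B; split=> //; right=> x; have := h x; rewrite -ltnNge => /ltnW.
have cSB : #|S :\: B| = r * l.
  by rewrite cardsD (finset.setIidPr sB) cS cB mulSn addKn.
have [h' [h'r h'l h'g]] := IH _ cSB.
exists (fun v => if v \in B then r else h' v).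
have h'S v : v \in S -> v \notin B -> h' v < r by move=> vS vB; apply: h'r; rewrite inE vB.
split=> [v vS|i ir|x].
- by case: ifPn => // /h'S /(_ ) ; [move=> h; apply: ltnW; rewrite ltnS; apply: h].
- move: ir; rewrite ltnS leq_eqVlt => /orP[/eqP ->|ir].
    rewrite -cB; congr #|pred_of_set _|; apply/setP => v; rewrite inE.
    case: ifPn => vB; first by rewrite eqxx (fintype.subsetP sB _ vB).
    by apply/negbTE/negP => /andP[/h'S /(_ vB)]; lia.
  rewrite -(h'l i ir); congr #|pred_of_set _|; apply/setP => v; rewrite !inE.
  by case: ifPn => vB //=; rewrite ?andbF //; apply/negbTE; rewrite negb_and; lia.
case: gB => [gB|gB]; last first.
  apply: leq_trans (gB x); apply: subset_leq_card; apply/fintype.subsetP => v.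
  by rewrite !inE => /and3P[-> ->].
apply: leq_trans (h'g x); apply: subset_leq_card; apply/fintype.subsetP => v.
rewrite !inE => /and3P[vS /eqP gv /existsP[u /and3P[uS hu gu]]].
move: hu; case: (boolP (u \in B)) => uB; case: (boolP (v \in B)) => vB //=.
- by rewrite (gB u v uB vB) gv eqxx in gu.
- by have := h'S v vS vB; lia.
- by have := h'S u uS uB; lia.
move=> hu; rewrite vS gv eqxx; apply/existsP; exists u.
by rewrite !inE uS uB hu gu.
Qed.

(** Defect form of the Cauchy-Schwarz inequality: a set [J] on which the average is at most
    [3 / 4 * d], while the overall average is at least [d], raises the sum of squares. *)
Lemma square_deviation_gain (R : realFieldType) (I : finType) (x : I -> R) (delta d : R)
    (J : {set I}) :
  (0 <= d)%R -> (d <= delta)%R -> (\sum_i x i = #|I|%:R * delta)%R ->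
  (\sum_(i in J) x i <= 3 / 4 * d * #|J|%:R)%R ->
  (#|I|%:R * delta ^+ 2 + #|J|%:R * d ^+ 2 / 16 <= \sum_i x i ^+ 2)%R.
Proof.
move=> d0 dd sx sJ.
have e1 : (\sum_i (x i - delta) ^+ 2 = \sum_i x i ^+ 2 - #|I|%:R * delta ^+ 2)%R.
  rewrite (eq_bigr (fun i => x i ^+ 2 + (delta ^+ 2 - 2 * delta * x i)))%R; last first.
    by move=> i _; ring.
  rewrite big_split sumrB sumr_const -mulr_sumr sx cardT -cardE -mulr_natl /=; ring.
have e2 : (\sum_(i in J) (x i - delta) ^+ 2 <= \sum_i (x i - delta) ^+ 2)%R.
  rewrite [leRHS](bigID (mem J)) /= lerDl; apply: sumr_ge0 => i _; exact: sqr_ge0.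
have e3 : (\sum_(i in J) ((d / 2 * delta - d ^+ 2 / 16) - d / 2 * x i)
           <= \sum_(i in J) (x i - delta) ^+ 2)%R.
  (* The square is bounded below by its tangent at deviation [- d / 4]. *)
  apply: ler_sum => i _; have := sqr_ge0 (x i - delta + d / 4)%R; lra.
have e4 : (\sum_(i in J) ((d / 2 * delta - d ^+ 2 / 16) - d / 2 * x i) =
  #|J|%:R * (d / 2 * delta - d ^+ 2 / 16) - d / 2 * \sum_(i in J) x i)%R.
  by rewrite sumrB sumr_const -mulr_sumr mulr_natl.
have J0 : (0 <= #|J|%:R :> R)%R by exact: ler0n.
have h1 := mulr_ge0 d0 (_ : 0 <= 3 / 4 * d * #|J|%:R - \sum_(i in J) x i)%R.
have h2 := mulr_ge0 (mulr_ge0 d0 J0) (_ : 0 <= delta - d)%R.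
have {}h1 := h1 ltac:(lra); have {}h2 := h2 ltac:(lra).
rewrite e1 in e2; rewrite e4 in e3; nra.
Qed.

(** * Refining a partition and its energy *)

Section Refinement.
Variables (V A : finType) (r l : nat) (P : V -> A) (Q : V -> A * 'I_r).
Hypothesis QP : forall v, (Q v).1 = P v.

Definition pieces (a : A) (I : {set 'I_r}) : {set V} :=
  [set v in cell P a | (Q v).2 \in I].

Lemma sum_pieces a (I : {set 'I_r}) (F : V -> nat) :
  \sum_(x in pieces a I) F x = \sum_(i in I) \sum_(x in cell Q (a, i)) F x.
Proof.
rewrite (partition_big (fun x => (Q x).2) (mem I)) /=.
  apply: eq_bigr => i iI; apply: eq_bigl => x; rewrite !inE -QP -pair_eqE /=.
  by case: (_ =P i) => [->|]; rewrite ?iI ?andbT ?andbF.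
by move=> x; rewrite inE => /andP[].
Qed.

Lemma ecount_pieces (H : rel V) a b (I J : {set 'I_r}) :
  ecount H (pieces a I) (pieces b J) =
  \sum_(i in I) \sum_(j in J) ecount H (cell Q (a, i)) (cell Q (b, j)).
Proof.
rewrite /ecount sum_pieces; apply: eq_bigr => i _.
rewrite [RHS]exchange_big /=; apply: eq_bigr => x _; exact: sum_pieces.
Qed.

Lemma pieces_setT a : pieces a [set: 'I_r] = cell P a.
Proof. by apply/setP => v; rewrite !inE andbT. Qed.

Hypothesis cQ : forall p, #|cell Q p| = l.

Lemma card_pieces a (I : {set 'I_r}) : #|pieces a I| = #|I| * l.
Proof.
rewrite -sum1_card sum_pieces -sum_nat_const; apply: eq_bigr => i _.
by rewrite sum1_card.
Qed.

Definition pure (a : A) (X : {set V}) : {set 'I_r} := [set i | cell Q (a, i) \subset X].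

Lemma pieces_pure a X : pieces a (pure a X) \subset X.
Proof.
apply/fintype.subsetP => v; rewrite !inE => /andP[/eqP <-] /fintype.subsetP; apply.
by rewrite inE -QP -surjective_pairing.
Qed.

(** A piece that meets [X] without lying inside it contains two values of [g], so the lost part of
    [X] is covered by the bad sets, one for each value of [g]. *)
Lemma card_pure (G : finType) (g : V -> G) a (X : {set V}) :
  X \subset cell P a ->
  (forall u v, u \in cell P a -> v \in cell P a -> g u = g v -> u \in X -> v \in X) ->
  (forall x, #|[set v in cell P a | (g v == x) &&
     [exists u in cell P a, ((Q u).2 == (Q v).2) && (g u != x)]]| <= l) ->
  #|X| <= #|pure a X| * l + #|G| * l.
Proof.
move=> sX gX hg; pose bad x := [set v in cell P a | (g v == x) &&
     [exists u in cell P a, ((Q u).2 == (Q v).2) && (g u != x)]].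
have : X \subset pieces a (pure a X) :|: \bigcup_x bad x.
  apply/fintype.subsetP => v vX; rewrite inE orbC -implyNb; apply/implyP => nb.
  have vP := fintype.subsetP sX _ vX; rewrite !inE in vP *; rewrite vP /=.
  apply/fintype.subsetP => u; rewrite inE => /eqP uQ.
  have uP : u \in cell P a by rewrite inE -QP uQ.
  apply: contraR nb => uX; apply/bigcupP; exists (g v) => //.
  rewrite !inE vP eqxx /=; apply/existsP; exists u; rewrite uP uQ eqxx /=.
  by apply: contraNneq uX => e; apply: (gX v u) => //; rewrite inE.
move=> /subset_leq_card h; apply: (leq_trans h); apply: leq_trans (leq_card_setU _ _) _.
rewrite card_pieces leq_add2l; rewrite -sum_nat_const.
apply: (big_ind2 (fun (Y : {set V}) n => #|Y| <= n)) => [|Y1 n1 Y2 n2 h1 h2|x _].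
- by rewrite cards0.
- by apply: leq_trans (leq_card_setU _ _) _; apply: leq_add.
exact: hg.
Qed.
End Refinement.

(* Diagonal pairs are treated like all others, so the cluster graph may have loops. *)
Definition irregular (V A : finType) (H : rel V) (P : V -> A) (L E q : nat) (p : A * A) :=
  (L ^ 2 <= q * ecount H (cell P p.1) (cell P p.2)) &&
  [exists X : {set V}, exists Y : {set V},
    [&& X \subset cell P p.1, Y \subset cell P p.2, L <= E * #|X|, L <= E * #|Y| &
        2 * q * ecount H X Y < #|X| * #|Y|]].

Definition density (V A : finType) (H : rel V) (P : V -> A) (L : nat) (p : A * A) : rat :=
  ((ecount H (cell P p.1) (cell P p.2))%:R / L%:R ^+ 2)%R.

Definition energy (V A : finType) (H : rel V) (P : V -> A) (L : nat) : rat :=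
  ((\sum_p density H P L p ^+ 2) / #|A|%:R ^+ 2)%R.

Lemma energy_le1 (V A : finType) (H : rel V) (P : V -> A) (L : nat) :
  (forall a, #|cell P a| = L) -> (energy H P L <= 1)%R.
Proof.
move=> cP; rewrite /energy; have [->|A0] := posnP #|A|.
  by rewrite expr0n invr0 mulr0.
rewrite ler_pdivrMr ?exprn_gt0 ?ltr0n // mul1r.
apply: (@le_trans _ _ (\sum_(p : A * A) 1)%R); last first.
  by rewrite sumr_const cardT -cardE card_prod natrM -expr2.
apply: ler_sum => p _; rewrite -(expr1n _ 2) lerXn2r ?nnegrE ?ler01 //.
  by rewrite /density divr_ge0 ?exprn_ge0 ?ler0n.
have [->|L0] := posnP L; first by rewrite /density expr0n invr0 mulr0.
rewrite /density ler_pdivrMr ?exprn_gt0 ?ltr0n // mul1r -natrX ler_nat -mulnn.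
by apply: leq_trans (ecount_le _ _ _) _; rewrite !cP.
Qed.

Section EnergyIncrement.
Variables (V A : finType) (H : rel V) (r l E q : nat) (P : V -> A).
Let L := r * l.
Hypothesis (E0 : 0 < E) (q0 : 0 < q) (l0 : 0 < l).
Hypothesis rE : r = 8 * E * 2 ^ (2 * #|A|).

Lemma card_label : #|{set A * bool}| = 2 ^ (2 * #|A|).
Proof. by rewrite -[LHS]cardsT -powersetT card_powerset cardsT card_prod card_bool mulnC. Qed.

(** The choice of [r] makes the loss [2 ^ (2 * #|A|) * l] at most an eighth of each witness. The
    pure parts keep [7 / 8] of each side, so their density is below
    [(8 / 7) ^ 2 / (2 * q) <= 3 / (4 * q)], and they consist of at least [r ^ 2 / (2 * E ^ 2)] pairs
    of pieces; with the factor [1 / 16] this gives the 32. *)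
Lemma pair_energy (Q : V -> A * 'I_r) (p : A * A) :
  (forall v, (Q v).1 = P v) -> (forall x, #|cell Q x| = l) ->
  (irregular H P L E q p -> exists X Y : {set V},
    [/\ X \subset cell P p.1, Y \subset cell P p.2, L <= E * #|X|, L <= E * #|Y| &
     [/\ 2 * q * ecount H X Y < #|X| * #|Y|,
        #|X| <= #|pure Q p.1 X| * l + 2 ^ (2 * #|A|) * l &
        #|Y| <= #|pure Q p.2 Y| * l + 2 ^ (2 * #|A|) * l]]) ->
  (r%:R ^+ 2 * density H P L p ^+ 2
     + (irregular H P L E q p)%:R * (r%:R ^+ 2 / (32 * E ^ 2 * q ^ 2)%:R)
   <= \sum_(ij : 'I_r * 'I_r) density H Q l ((p.1, ij.1), (p.2, ij.2)) ^+ 2)%R.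
Proof.
case: p => a b /= QP cQ wit.
have r0 : 0 < r by rewrite rE !muln_gt0 E0 expn_gt0.
have lR : (0 < l%:R :> rat)%R by rewrite ltr0n.
have rR : (0 < r%:R :> rat)%R by rewrite ltr0n.
pose x (ij : 'I_r * 'I_r) := density H Q l ((a, ij.1), (b, ij.2)).
have sumx (I J : {set 'I_r}) : (\sum_(ij in finset.setX I J) x ij =
    (ecount H (pieces P Q a I) (pieces P Q b J))%:R / l%:R ^+ 2)%R.
  rewrite (eq_bigl (fun ij : 'I_r * 'I_r => (ij.1 \in I) && (ij.2 \in J))); last first.
    by move=> ij; rewrite inE.
  rewrite -(pair_big (mem I) (mem J) (fun i j => x (i, j))) /=.
  rewrite (ecount_pieces QP) natr_sum mulr_suml; apply: eq_bigr => i _.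
  by rewrite natr_sum mulr_suml.
have sumxT : (\sum_ij x ij = #|{: 'I_r * 'I_r}|%:R * density H P L (a, b))%R.
  have := sumx [set: 'I_r] [set: 'I_r]; rewrite !pieces_setT /density /= /L => h.
  rewrite card_prod card_ord (eq_bigl (mem (finset.setX [set: 'I_r] [set: 'I_r]))).
    by rewrite h !natrM; field; rewrite !gt_eqF.
  by move=> ij; rewrite !inE.
have dev := @square_deviation_gain rat _ x (density H P L (a, b)).
have [irr|reg] := boolP (irregular H P L E q (a, b)); last first.
  have := dev 0%R finset.set0 (lexx _) _ sumxT _; rewrite card_prod card_ord.
  rewrite big_set0 cards0 !mulr0 !mul0r !addr0 natrM -expr2; apply=> //.
  by rewrite /density divr_ge0 ?exprn_ge0 ?ler0n.
have [X [Y [sX sY EX EY [eXY pX pY]]]] := wit irr.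
set I := pure Q a X in pX; set J := pure Q b Y in pY.
have eIJ : ecount H (pieces P Q a I) (pieces P Q b J) <= ecount H X Y.
  by apply: ecount_mono; exact: pieces_pure.
have X8 : 8 * (2 ^ (2 * #|A|) * l) <= #|X|.
  by rewrite -(leq_pmul2l E0) (leq_trans _ EX) // /L rE !mulnA; lia.
have Y8 : 8 * (2 ^ (2 * #|A|) * l) <= #|Y|.
  by rewrite -(leq_pmul2l E0) (leq_trans _ EY) // /L rE !mulnA; lia.
have IX : 7 * #|X| <= 8 * (#|I| * l) by move: X8 pX; move: (2 ^ (2 * #|A|) * l) (#|I| * l) (#|X|) => *; lia.
have JY : 7 * #|Y| <= 8 * (#|J| * l) by move: Y8 pY; move: (2 ^ (2 * #|A|) * l) (#|J| * l) (#|Y|) => *; lia.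
have IE : 7 * r <= 8 * (E * #|I|).
  by rewrite -(leq_pmul2r l0); have := leq_mul (leqnn E) IX; move: EX; rewrite /L; lia.
have JE : 7 * r <= 8 * (E * #|J|).
  by rewrite -(leq_pmul2r l0); have := leq_mul (leqnn E) JY; move: EY; rewrite /L; lia.
have IJXY := leq_mul IX JY.
have IJE := leq_mul IE JE.
have cIJ : #|finset.setX I J| = #|I| * #|J| by rewrite cardsX.
have qR : (0 < q%:R :> rat)%R by rewrite ltr0n.
have ER : (0 < E%:R :> rat)%R by rewrite ltr0n.
have F3 : 4 * q * ecount H (pieces P Q a I) (pieces P Q b J) <= 3 * (#|I| * #|J| * l ^ 2).
  have : 2 * q * ecount H (pieces P Q a I) (pieces P Q b J) <= #|X| * #|Y|.
    by apply: leq_trans (ltnW eXY); rewrite leq_mul2l eIJ orbT.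
  move: IJXY; rewrite -(mulnn l); move: (#|X|) (#|Y|) (#|I|) (#|J|) => *; nia.
have F4 : r ^ 2 <= 2 * E ^ 2 * (#|I| * #|J|).
  move: IJE; rewrite -!mulnn; move: (#|I|) (#|J|) => *; nia.
have lR2 : (0 < l%:R ^+ 2 :> rat)%R by rewrite exprn_gt0.
have h := dev (q%:R^-1)%R (finset.setX I J) _ _ sumxT _.
apply: (le_trans _ (h _ _ _)).
- rewrite card_prod card_ord cIJ mul1r (natrM _ r r) -expr2 lerD2l.
  rewrite ler_pdivrMr ?ltr0n ?muln_gt0 ?expn_gt0 ?E0 ?q0 //.
  move: F4; rewrite -(ler_nat rat) !(natrX, natrM) => F4.
  apply: (le_trans F4); rewrite [leRHS](_ : _ = 2 * E%:R ^+ 2 * (#|I|%:R * #|J|%:R))%R //.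
  by field; rewrite gt_eqF.
- by rewrite invr_ge0 ltW.
- case/andP: irr => /= irr _; move: irr; rewrite -(ler_nat rat) natrX natrM => irr.
  rewrite /density /= ler_pdivlMr ?exprn_gt0 ?ltr0n ?muln_gt0 ?r0 //.
  by rewrite mulrC ler_pdivrMr // mulrC.
rewrite sumx cIJ ler_pdivrMr //.
move: F3; rewrite -(ler_nat rat) !(natrX, natrM) => F3.
rewrite -(ler_pM2l (_ : 0 < 4 * q%:R)%R) ?mulr_gt0 //.
apply: (le_trans F3).
rewrite [leRHS](_ : _ = 3 * (#|I|%:R * #|J|%:R * l%:R ^+ 2))%R //.
by rewrite ?natrM; field; rewrite gt_eqF.
Qed.
End EnergyIncrement.

Lemma regularity_refine (V A : finType) (H : rel V) (r l E q : nat) (P : V -> A) :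
  (forall a, #|cell P a| = r * l) -> 0 < E -> 0 < q -> 0 < l -> 0 < #|A| ->
  r = 8 * E * 2 ^ (2 * #|A|) ->
  #|A| ^ 2 < q * #|[set p | irregular H P (r * l) E q p]| ->
  exists2 Q : V -> A * 'I_r, forall x, #|cell Q x| = l
    & (energy H P (r * l) + (32 * E ^ 2 * q ^ 3)%:R^-1 <= energy H Q l)%R.
Proof.
move=> cP E0 q0 l0 A0 rE irr.
have r0 : 0 < r by rewrite rE !muln_gt0 E0 expn_gt0.
have [W hW] : exists W : A * A -> {set V} * {set V}, forall p, irregular H P (r * l) E q p ->
    [/\ (W p).1 \subset cell P p.1, (W p).2 \subset cell P p.2,
      r * l <= E * #|(W p).1|, r * l <= E * #|(W p).2|
      & 2 * q * ecount H (W p).1 (W p).2 < #|(W p).1| * #|(W p).2|].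
  apply: (@fin_all_exists _ (fun _ => _) (fun p (w : {set V} * {set V}) => irregular H P _ E q p ->
    [/\ w.1 \subset cell P p.1, w.2 \subset cell P p.2,
      r * l <= E * #|w.1|, r * l <= E * #|w.2|
      & 2 * q * ecount H w.1 w.2 < #|w.1| * #|w.2|])) => p.
  case: (boolP (irregular H P (r * l) E q p)) => [/andP[_]|_]; last by exists (finset.set0, finset.set0).
  by move=> /existsP[X /existsP[Y /and5P[h1 h2 h3 h4 h5]]]; exists (X, Y).
(* The value [g v] records which witnesses contain [v], for the pairs with the cell of [v] in first
   or in second place: [2 * #|A|] bits, so that every witness is a union of fibres of [g] within its
   cell. *)
pose g v : {set A * bool} :=
  [set z | v \in if z.2 then (W (P v, z.1)).1 else (W (z.1, P v)).2].
have [h hh] := @fin_all_exists A (fun _ => V -> nat) _ (fun a => chop g (cP a)).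
have [Q QP valQ] : exists2 Q : V -> A * 'I_r, forall v, (Q v).1 = P v
    & forall v, (Q v).2 = h (P v) v :> nat.
  exists (fun v => (P v, insubd (Ordinal r0) (h (P v) v))) => v //.
  by have [hr _ _] := hh (P v); rewrite /= val_insubd hr //; rewrite inE.
have cQ x : #|cell Q x| = l.
  case: x => a i; have [_ hc _] := hh a; rewrite -(hc i (ltn_ord i)).
  congr #|pred_of_set _|; apply/setP => v; rewrite !inE -pair_eqE /= QP.
  by case: (P v =P a) => //= <-; rewrite -val_eqE /= valQ.
exists Q => //.
have bad a x : #|[set v in cell P a | (g v == x) &&
     [exists u in cell P a, ((Q u).2 == (Q v).2) && (g u != x)]]| <= l.
  have [_ _ hb] := hh a; apply: leq_trans (hb x); apply: subset_leq_card.
  apply/fintype.subsetP => v; rewrite !inE => /and3P[/eqP va -> /existsP[u]].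
  rewrite !inE -val_eqE /= !valQ => /and3P[/eqP ua hu gu].
  rewrite va eqxx /=; apply/existsP; exists u; rewrite inE ua eqxx gu andbT /=.
  by move: hu; rewrite ua va.
have pairE p := @pair_energy V A H r l E q P E0 q0 l0 rE Q p QP cQ.
have wit p : irregular H P (r * l) E q p -> exists X Y : {set V},
    [/\ X \subset cell P p.1, Y \subset cell P p.2, r * l <= E * #|X|, r * l <= E * #|Y| &
     [/\ 2 * q * ecount H X Y < #|X| * #|Y|,
        #|X| <= #|pure Q p.1 X| * l + 2 ^ (2 * #|A|) * l &
        #|Y| <= #|pure Q p.2 Y| * l + 2 ^ (2 * #|A|) * l]].
  move=> /hW[s1 s2 l1 l2 e]; exists (W p).1, (W p).2; split=> //; split=> //.
    rewrite -card_label; apply: (card_pure QP cQ (g := g)) => // u v.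
    rewrite !inE => /eqP up /eqP vp /setP /(_ (p.2, true)); rewrite !inE /= up vp.
    by rewrite -surjective_pairing => -> .
  rewrite -card_label; apply: (card_pure QP cQ (g := g)) => // u v.
  rewrite !inE => /eqP up /eqP vp /setP /(_ (p.1, false)); rewrite !inE /= up vp.
  by rewrite -surjective_pairing => -> .
have {pairE wit}pairE p := pairE p (wit p).
have AR : (0 < #|A|%:R :> rat)%R by rewrite ltr0n.
have rR : (0 < r%:R :> rat)%R by rewrite ltr0n.
have ER : (0 < E%:R :> rat)%R by rewrite ltr0n.
have qR : (0 < q%:R :> rat)%R by rewrite ltr0n.
have sumQ : (\sum_x density H Q l x ^+ 2 = \sum_(p : A * A) \sum_(ij : 'I_r * 'I_r)
     density H Q l ((p.1, ij.1), (p.2, ij.2)) ^+ 2)%R.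
  rewrite pair_bigA /= (reindex (fun z : (A * A) * ('I_r * 'I_r) =>
    ((z.1.1, z.2.1), (z.1.2, z.2.2)))) //=.
  exists (fun z : (A * 'I_r) * (A * 'I_r) => ((z.1.1, z.2.1), (z.1.2, z.2.2))).
    by move=> [[? ?] [? ?]].
  by move=> [[? ?] [? ?]].
rewrite /energy sumQ card_prod card_ord ler_pdivlMr ?exprn_gt0 ?natrM ?mulr_gt0 //.
apply: le_trans (ler_sum _ (fun p _ => pairE p)).
rewrite big_split /= -mulr_sumr -mulr_suml -natr_sum.
set S := (\sum_p _ ^+ 2)%R.
have -> : (\sum_p (irregular H P (r * l) E q p : nat)) = #|[set p | irregular H P (r * l) E q p]|.
  by rewrite -sum1dep_card [RHS]big_mkcond /=; apply: eq_bigr => p _; case: irregular.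
set m := #|[set p | _]| in irr *.
move: irr; rewrite -(ltr_nat rat) natrX natrM => /ltW irr.
rewrite !(natrX, natrM).
rewrite [leLHS](_ : _ = r%:R ^+ 2 * S + #|A|%:R ^+ 2 * (r%:R ^+ 2 / (32 * E%:R ^+ 2 * q%:R ^+ 3)))%R; last first.
  by field; rewrite !gt_eqF.
rewrite lerD2l.
rewrite [leRHS](_ : _ = q%:R * m%:R * (r%:R ^+ 2 / (32 * E%:R ^+ 2 * q%:R ^+ 3)))%R; last first.
  by field; rewrite !gt_eqF.
have c0 : (0 < r%:R ^+ 2 / (32 * E%:R ^+ 2 * q%:R ^+ 3) :> rat)%R.
  apply: divr_gt0; first exact: exprn_gt0.
  apply: mulr_gt0; last exact: exprn_gt0.
  by apply: mulr_gt0; [rewrite ltr0n|exact: exprn_gt0].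
by rewrite (ler_pM2r c0).
Qed.

(** The number of cells after [j] refinements. Each value divides the next, so a single divisibility
    condition on [#|V|] makes the cells equal in size at every stage. *)
Fixpoint part_count (E j : nat) : nat :=
  if j is j'.+1 then part_count E j' * (8 * E * 2 ^ (2 * part_count E j')) else 1.

Lemma part_count_gt0 E j : 0 < E -> 0 < part_count E j.
Proof. by move=> E0; elim: j => //= j IH; rewrite !muln_gt0 IH E0 expn_gt0. Qed.

Lemma part_count_dvd E i j : i <= j -> part_count E i %| part_count E j.
Proof.
move=> /subnK <-; elim: (j - i) => //= k IH.
by rewrite dvdn_mulr.
Qed.

(** While too many pairs are irregular, each refinement adds [1 / n] to the energy, which never
    exceeds 1; this cannot happen [n + 1] times. *)
Theorem regularity (E q : nat) : 0 < E -> 0 < q ->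
  exists2 K, 0 < K & forall (V : finType) (H : rel V), 0 < #|V| -> K %| #|V| ->
  exists (A : finType) (P : V -> A) (L : nat),
    [/\ forall a, #|cell P a| = L, 0 < L, 0 < #|A|, #|A| <= K
      & q * #|[set p | irregular H P L E q p]| <= #|A| ^ 2].
Proof.
move=> E0 q0; pose n := 32 * E ^ 2 * q ^ 3; pose K := part_count E n.+2.
have K0 : 0 < K := part_count_gt0 _ E0.
exists K => // V H V0 KV.
have pc j : j <= n.+2 -> #|V| = part_count E j * (#|V| %/ part_count E j).
  by move=> jn; rewrite mulnC divnK // (dvdn_trans (part_count_dvd _ jn)).
pose good := exists (A : finType) (P : V -> A) (L : nat),
    [/\ forall a, #|cell P a| = L, 0 < L, 0 < #|A|, #|A| <= K
      & q * #|[set p | irregular H P L E q p]| <= #|A| ^ 2].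
have step j : j <= n.+1 -> good \/ exists (A : finType) (P : V -> A),
    [/\ #|A| = part_count E j, forall a, #|cell P a| = #|V| %/ part_count E j &
      (j%:R * n%:R^-1 <= energy H P (#|V| %/ part_count E j))%R].
  elim: j => [_|j IH jn].
    right; exists unit, (fun _ => tt); rewrite card_unit; split=> //.
      by move=> a /=; rewrite divn1 -cardsT; congr #|pred_of_set _|; apply/setP=> v; rewrite !inE; case: a.
    by rewrite mul0r /energy divr_ge0 // ?exprn_ge0 // sumr_ge0 // => p _; exact: sqr_ge0.
  have [|[A [P [cA cP eP]]]] := IH (ltnW jn); first by left.
  set L := #|V| %/ part_count E j in cP eP.
  have L0 : 0 < L.
    have := pc j (leqW (ltnW jn)); rewrite -/L; have := V0.
    by case: (posnP L) => // ->; rewrite muln0 => /[swap] ->.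
  have A0 : 0 < #|A| by rewrite cA part_count_gt0.
  have AK : #|A| <= K by rewrite cA dvdn_leq // part_count_dvd //; lia.
  have [le|lt] := leqP (q * #|[set p | irregular H P L E q p]|) (#|A| ^ 2).
    by left; exists A, P, L.
  right; pose r := 8 * E * 2 ^ (2 * #|A|); set l := #|V| %/ part_count E j.+1.
  have Lrl : L = r * l.
    have e1 := pc j (leqW (ltnW jn)); have e2 := pc j.+1 (leqW jn).
    rewrite -/L in e1; rewrite -/l /= -cA -/r -mulnA in e2.
    by apply/eqP; rewrite -(eqn_pmul2l A0) -e2 {1}cA -e1.
  have l0 : 0 < l by move: L0; rewrite Lrl muln_gt0 => /andP[].
  rewrite Lrl in lt; have cP' a : #|cell P a| = r * l by rewrite cP Lrl.
  rewrite Lrl in eP.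
  have [Q cQ eQ] := regularity_refine cP' E0 q0 l0 A0 erefl lt.
  exists (A * 'I_r)%type, Q; split=> //=.
    by rewrite card_prod card_ord cA /r cA.
  by apply: le_trans eQ; rewrite -addn1 natrD mulrDl mul1r lerD2r.
have [//|[A [P [cA cP eP]]]] := step n.+1 (leqnn _).
have := le_trans eP (energy_le1 H cP).
have n0 : (0 < n%:R :> rat)%R by rewrite ltr0n /n !(expn_gt0, muln_gt0) E0 q0.
by rewrite ler_pdivrMr // mul1r ler_nat ltnn.
Qed.

(** * Long cycles from connected matchings *)

Section GreedyEmbedding.
Variables (V A : finType) (H : rel V) (P : V -> A) (Rr : rel A) (L E Q g : nat).
Hypothesis Hirr : irreflexive H.
Hypothesis Hsym : symmetric H.
Hypothesis Rsym : symmetric Rr.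
Hypothesis cP : forall a, #|cell P a| = L.
Hypothesis L0 : 0 < L.
Hypothesis Q2 : 2 <= Q.
Hypothesis gE : L * Q <= E * g.
Hypothesis dense : forall a b (X Y : {set V}), Rr a b -> X \subset cell P a ->
  Y \subset cell P b -> L <= E * #|X| -> L <= E * #|Y| -> #|X| * #|Y| <= Q * ecount H X Y.

Definition nbrs (x : V) (Y : {set V}) : {set V} := [set y in Y | H x y].

Definition poor (Y : {set V}) (a : A) : {set V} :=
  [set x in cell P a | Q * #|nbrs x Y| < #|Y|].

Lemma card_nbrs x Y : #|nbrs x Y| = \sum_(y in Y) (H x y : nat).
Proof.
rewrite -sum1_card big_mkcond [RHS]big_mkcond; apply: eq_bigr => y _.
by rewrite inE; case: (y \in Y) => //=; case: (H x y).
Qed.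

Lemma few_poor a b (Y : {set V}) :
  Rr a b -> Y \subset cell P b -> L <= E * #|Y| -> E * #|poor Y a| < L.
Proof.
move=> ab sY LY; rewrite ltnNge; apply/negP => LX.
have sX : poor Y a \subset cell P a by apply/fintype.subsetP => x; rewrite inE => /andP[].
have := dense ab sX sY LX LY; apply/negP; rewrite -ltnNge /ecount big_distrr /=.
have X0 : 0 < #|poor Y a| by move: LX; case: #|poor Y a| => //; rewrite muln0; lia.
have [x xX] : exists x, x \in poor Y a by apply/set0Pn; rewrite -card_gt0.
rewrite -sum_nat_const (bigD1 x) //= [ltnRHS](bigD1 x) //= -addSn.
apply: leq_add; first by rewrite -card_nbrs; move: xX; rewrite inE => /andP[].
by apply: leq_sum => y /andP[+ _]; rewrite inE -card_nbrs => /andP[_ /ltnW].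
Qed.

(* Where the next vertex of the walk is sought; the reserved set [S] of neighbours
   of the first vertex is used at the end, to close the cycle. *)
Definition target (F S : {set V}) (s : seq A) : {set V} :=
  if s is d :: _ then cell P d :\: F else S.

(** A vertex that is used up may leave the target of [x], but it is not a neighbour of [x], so the
    proportion of neighbours does not drop. *)
Lemma target_poor x y (F S : {set V}) s : S \subset F -> y \notin F ->
  #|target F S s| <= Q * #|nbrs x (target F S s)| -> (y = x \/ ~~ H x y) ->
  #|target (y |: F) S s| <= Q * #|nbrs x (target (y |: F) S s)|.
Proof.
move=> SF yF; case: s => [|d s] //= h xy.
have yN : ~~ H x y by case: xy => // ->; rewrite Hirr.
have -> : nbrs x (cell P d :\: (y |: F)) = nbrs x (cell P d :\: F).
  apply/setP => z; rewrite !inE negb_or; have [->|//] := eqVneq z y.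
  by rewrite (negbTE yN) !andbF.
apply: leq_trans h; apply: subset_leq_card; apply: finset.setDS; exact: finset.subsetUr.
Qed.

Lemma cell_size_le : L <= E * g.
Proof. by apply: leq_trans gE; rewrite leq_pmulr //; lia. Qed.

(** The invariant is that the current vertex [x] sees a proportion [1 / Q] of the next target. As
    [g] vertices of each cluster always stay free, these neighbours number at least [L / E], more
    than the vertices poor towards the target after that; so one of them keeps the invariant. The
    last target is [S], and hitting it closes the cycle. *)
Lemma greedy_walk s : forall a b x (F S : {set V}),
  path Rr a (rcons s b) -> S \subset cell P b -> S \subset F -> L <= E * #|S| ->
  (forall c, #|F :&: cell P c| + count_mem c s + g <= L) ->
  #|target F S s| <= Q * #|nbrs x (target F S s)| ->
  exists xs z, [/\ map P xs = s, uniq xs, forall y, y \in xs -> y \notin F,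
     path H x xs & z \in S /\ H (last x xs) z].
Proof.
elim: s => [|c s IH] a b x F S /= pth Sb SF LS av tx.
  have S0 : 0 < #|S| by move: LS; case: #|S| => //; rewrite muln0; lia.
  have : 0 < #|nbrs x S| by move: tx; case: #|nbrs x S| => //; rewrite muln0; lia.
  rewrite card_gt0 => /set0Pn[z]; rewrite inE => /andP[zS xz].
  by exists [::], z.
case/andP: pth => ac pth.
have cT d : #|cell P d :\: F| = L - #|F :&: cell P d|.
  by rewrite cardsD cP finset.setIC.
have T'E : L <= E * #|target F S s|.
  case: s {IH} pth av tx => [|d s] //= _ av _; apply: leq_trans cell_size_le _.
  by rewrite leq_mul2l cT; have := av d; rewrite eqxx; lia.
have [d cd T'd] : exists2 d, Rr c d & target F S s \subset cell P d.
  case: s {IH av tx T'E} pth => [|d s] /= /andP[cd _]; first by exists b.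
  by exists d => //; exact: finset.subsetDl.
have few := few_poor cd T'd T'E.
have many : L <= E * #|nbrs x (cell P c :\: F)|.
  have gT : g <= #|cell P c :\: F| by rewrite cT; have := av c; rewrite eqxx; lia.
  have Q0 : 0 < Q by lia.
  rewrite -(leq_pmul2r Q0); apply: leq_trans gE _.
  by rewrite -mulnA leq_mul2l mulnC (leq_trans gT tx) orbT.
have [y] : exists y, y \in nbrs x (cell P c :\: F) :\: poor (target F S s) c.
  apply/set0Pn; rewrite -card_gt0 cardsD.
  have h := subset_leq_card (finset.subsetIr (nbrs x (cell P c :\: F)) (poor (target F S s) c)).
  have lt := leq_trans few many.
  have E0 : 0 < E by case: (E) lt => //; rewrite !mul0n.
  by rewrite ltn_pmul2l // in lt; lia.
rewrite !inE => /andP[+ /andP[/andP[yF /eqP yc] xy]].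
rewrite yc eqxx /= -leqNgt => ty.
have av' e : #|(y |: F) :&: cell P e| + count_mem e s + g <= L.
  apply: leq_trans (av e); rewrite /= addnA !leq_add2r.
  have : #|(y |: F) :&: cell P e| <= #|F :&: cell P e| + (c == e).
    rewrite finset.setIUl; apply: leq_trans (leq_card_setU _ _) _; rewrite addnC leq_add2l.
    have [<-|ne] := eqVneq c e.
      by apply: leq_trans (subset_leq_card (finset.subsetIl _ _)) _; rewrite cards1.
    rewrite leqn0 cards_eq0; apply/eqP/setP => v; rewrite !inE.
    by apply/negbTE; apply: contra ne => /andP[/eqP -> ]; rewrite yc.
  by [].
have SF' : S \subset y |: F by apply: (fintype.subset_trans SF); exact: finset.subsetUr.
have ty' := target_poor SF yF ty (or_introl erefl).
have [xs [z [mp un nF pt [zS lz]]]] := IH c b y (y |: F) S pth Sb SF' LS av' ty'.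
exists (y :: xs), z; split=> //=.
- by rewrite mp yc.
- by rewrite un andbT; apply/negP => /nF; rewrite !inE eqxx.
- move=> v; rewrite inE => /orP[/eqP -> //|/nF]; by rewrite !inE negb_or => /andP[].
by rewrite xy.
Qed.

Definition has_cycle (U : eqType) (h : rel U) (t : nat) :=
  exists w : seq U, [/\ size w = t, uniq w & cycle h w].

(** A set [W] of size [g] is reserved in the last cluster, and the first vertex [x] is chosen with
    many neighbours in [W]; those form the final target. One [g] in the visit bound pays for [W],
    the other for the slack of the greedy choice. Avoiding [W] and two poor sets in choosing [x]
    costs less than [3 * g]. *)
Lemma closed_walk_cycle (a b d : A) (s : seq A) :
  path Rr a (rcons (d :: s) b) -> Rr b a -> 3 * g <= L ->
  (forall c, count_mem c (a :: d :: s) + 2 * g <= L) ->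
  has_cycle H (size s + 3).
Proof.
move=> pth ba g3 av.
have [W sW cW] : exists2 W : {set V}, W \subset cell P b & #|W| = g.
  by apply: exists_subset_card; rewrite cP; lia.
have ab : Rr a b by rewrite Rsym.
have ad : Rr a d by case/andP: pth.
have cT c : L - g <= #|cell P c :\: W|.
  rewrite cardsD cP leq_sub2l // -cW; exact: subset_leq_card (finset.subsetIr _ _).
have EW : L <= E * #|W| by rewrite cW cell_size_le.
have ET : L <= E * #|cell P d :\: W|.
  by apply: leq_trans cell_size_le _; rewrite leq_mul2l (leq_trans _ (cT d)) ?orbT //; lia.
have small (X : {set V}) : E * #|X| < L -> #|X| < g.
  move=> h; have lt := leq_trans h cell_size_le; have E0 : 0 < E by case: (E) lt => //; rewrite !mul0n.
  by rewrite ltn_pmul2l in lt.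
have f1 := small _ (few_poor ab sW EW).
have f2 := small _ (few_poor ad (finset.subsetDl _ _) ET).
have [x] : exists x, x \in cell P a :\: (W :|: poor W a :|: poor (cell P d :\: W) a).
  apply/set0Pn; rewrite -card_gt0 cardsD cP.
  set U := _ :|: _; have : #|U| <= #|W| + #|poor W a| + #|poor (cell P d :\: W) a|.
    by apply: leq_trans (leq_card_setU _ _) _; rewrite leq_add2r leq_card_setU.
  by have := subset_leq_card (finset.subsetIr (cell P a) U); lia.
rewrite !inE !negb_or => /andP[/andP[/andP[xW +] +] /eqP xa].
rewrite xa eqxx /= -!leqNgt => p1 p2.
pose S := nbrs x W; pose F := x |: W.
have SW : S \subset W by apply/fintype.subsetP => y; rewrite inE => /andP[].
have ES : L <= E * #|S|.
  have Q0 : 0 < Q by lia.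
  rewrite -(leq_pmul2r Q0); apply: leq_trans gE _.
  by rewrite -mulnA leq_mul2l mulnC -cW p1 orbT.
have tx := @target_poor x x W S (d :: s) SW xW p2 (or_introl erefl).
have avF c : #|F :&: cell P c| + count_mem c (d :: s) + g <= L.
  have : #|F :&: cell P c| <= (a == c) + g.
    rewrite finset.setIUl; apply: leq_trans (leq_card_setU _ _) _.
    apply: leq_add; last by rewrite -cW; apply: subset_leq_card (finset.subsetIl _ _).
    have [<-|ne] := eqVneq a c.
      by apply: leq_trans (subset_leq_card (finset.subsetIl _ _)) _; rewrite cards1.
    rewrite leqn0 cards_eq0; apply/eqP/setP => v; rewrite !inE.
    by apply/negbTE; apply: contra ne => /andP[/eqP -> ]; rewrite xa.
  by have := av c => /=; lia.
have SF : S \subset F by apply: (fintype.subset_trans SW); exact: finset.subsetUr.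
have Sb := fintype.subset_trans SW sW.
have [xs [z [mp un nF pt [zS lz]]]] := greedy_walk pth Sb SF ES avF tx.
have zW := fintype.subsetP SW _ zS; move: (zS); rewrite inE => /andP[_ xz].
exists (x :: rcons xs z); split.
- by rewrite /= size_rcons -(size_map P) mp /= addn3.
- rewrite /= rcons_uniq un andbT mem_rcons inE negb_or.
  rewrite (contraNneq _ xW); last by move=> ->.
  have -> /= : z \notin xs by apply/negP => /nF; rewrite !inE zW orbT.
  by rewrite andbT; apply/negP => /nF; rewrite !inE eqxx.
by rewrite /cycle !rcons_path pt lz last_rcons Hsym xz.
Qed.
End GreedyEmbedding.

(** * Closed walks of prescribed even length *)

Section ClosedWalks.
Variables (A : finType) (R : rel A).
Hypothesis Rsym : symmetric R.

Lemma zigzag (a b : A) n : R a b -> exists z, [/\ path R a z, last a z = a, size z = 2 * n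
  & forall c, count_mem c z = n * ((a == c) + (b == c))].
Proof.
move=> ab; elim: n => [|n [z [pz lz sz cz]]]; first by exists [::].
exists [:: b, a & z]; split=> //=.
- by rewrite ab Rsym ab.
- by rewrite sz mulnS add2n.
by move=> c; rewrite cz mulSn addnCA addnA.
Qed.

(** For each pair the walk goes from [rt] to the pair, zigzags there and returns by the same path,
    so its length is even whatever the parity structure of the component. The travel cost [B] does
    not depend on [f], which leaves [f] free to adjust the length exactly. *)
Lemma excursions (rt : A) (D : seq (A * A)) :
  (forall p, p \in D -> R p.1 p.2 /\ connect R rt p.1) ->
  exists2 B, B <= size D * #|A| & forall f : A * A -> nat, exists w,
    [/\ path R rt w, last rt w = rt, size w = 2 * (B + \sum_(p <- D) f p)
     & forall c, count_mem c w <= 2 * #|A| * size D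
          + \sum_(p <- D) f p * ((p.1 == c) + (p.2 == c))].
Proof.
elim: D => [_|p D IH hD].
  by exists 0 => // f; exists [::]; split=> //; rewrite !big_nil.
have [|B BD hB] := IH; first by move=> q qD; apply: hD; rewrite inE qD orbT.
have [pR /connectP[t0 pt0 lt0]] := hD p (mem_head _ _).
have [t [pt ut lt]] : exists t, [/\ path R rt t, uniq (rt :: t) & last rt t = p.1].
  by case/shortenP: pt0 lt0 => t pt ut _ lt; exists t.
have st : size t <= #|A|.
  by have := card_uniqP ut => /= h; apply: ltnW; rewrite -[(size t).+1]h max_card.
exists (size t + B) => [|f]; first by rewrite /= mulSn leq_add.
have [w [pw lw sw cw]] := hB f.
have [z [pz lz sz cz]] := zigzag (f p) pR.
exists (t ++ z ++ rev (belast rt t) ++ w).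
have back : path R p.1 (rev (belast rt t)).
  rewrite -lt rev_path; apply: sub_path pt => x y; by rewrite Rsym.
have lback : last p.1 (rev (belast rt t)) = rt.
  by case: (t) lt => [/= ->//|y t' _]; rewrite /= rev_cons last_rcons.
split.
- by rewrite !cat_path pt lt pz lz back lback pw.
- by rewrite !last_cat lt lz lback lw.
- by rewrite !size_cat size_rev size_belast sw sz big_cons; move: (f p) (\sum_(_ <- _) _) => x y; lia.
move=> c; rewrite !count_cat big_cons cz count_rev /=.
have h1 : count_mem c t <= #|A| by apply: leq_trans (count_size _ _) st.
have h2 : count_mem c (belast rt t) <= #|A|.
  by apply: leq_trans (count_size _ _) _; rewrite size_belast.
rewrite mulnS; move: h1 h2 (cw c); set x1 := count_mem c t; set x2 := count_mem c _.
set x3 := count_mem c w; set y1 := f p * _; set y2 := \sum_(_ <- _) _; set y3 := _ * size D.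
clearbody x1 x2 x3 y1 y2 y3; move: (#|A|) => k; clear; lia.
Qed.

Lemma spread (T : eqType) (D : seq T) (M t : nat) : uniq D -> t <= size D * M ->
  exists2 f : T -> nat, forall p, f p <= M & \sum_(p <- D) f p = t.
Proof.
elim: D t => [|p D IH] t /=.
  by rewrite mul0n leqn0 => _ /eqP ->; exists (fun _ => 0); rewrite ?big_nil.
move=> /andP[pD uD] tM.
have [|f fM ft] := IH (t - minn M t) uD; first by rewrite mulSn in tM; lia.
exists (fun q => if q == p then minn M t else f q) => [q|].
  by case: eqP => // _; exact: geq_minl.
rewrite big_cons eqxx (eq_big_seq f); first by rewrite ft; lia.
by move=> q qD; case: eqP => // e; rewrite -e qD in pD.
Qed.

(** A cluster is the first entry of at most one pair and the second entry of at most one pair, hence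
    the factor 2. *)
Lemma matching_count (M : {set A * A}) (g : A * A -> nat) x c : matching M ->
  (forall p, g p <= x) ->
  \sum_(p <- enum M) g p * ((p.1 == c) + (p.2 == c)) <= 2 * x.
Proof.
move=> mM gx.
have one (pr : A * A -> A) : (forall p q, p \in M -> q \in M -> pr p = pr q -> p = q) ->
    \sum_(p <- enum M) g p * (pr p == c) <= x.
  move=> inj; rewrite big_enum /=.
  have [/existsP[p /andP[pM /eqP pc]]|/existsPn h] := boolP [exists p, (p \in M) && (pr p == c)].
    rewrite (bigD1 p) //= big1 ?addn0 => [|q /andP[qM qp]].
      by apply: leq_trans (gx p); case: (_ == _); rewrite ?muln1 ?muln0.
    case: eqP => [e|]; last by rewrite muln0.
    by rewrite (inj q p qM pM) ?eqxx // in qp; rewrite e pc.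
  rewrite big1 // => p pM; have := h p; rewrite pM => /negbTE /= ->; exact: muln0.
under eq_bigr => p _ do rewrite mulnDr.
rewrite big_split /= mul2n -addnn; apply: leq_add; apply: one => p q pM qM e.
  by apply: mM => //; rewrite e eqxx.
by apply: mM => //; rewrite e eqxx orbT.
Qed.
End ClosedWalks.

Lemma card_matching (A : finType) (M : {set A * A}) : matching M -> #|M| <= #|A|.
Proof.
move=> mM; rewrite -(@card_in_imset _ _ (fun p : A * A => p.1) M) ?max_card //.
by move=> p q pM qM /= e; apply: mM => //; rewrite e eqxx.
Qed.

(** The zigzags visit a cluster at most [L - 4 * g] times and the travelling at most
    [2 * #|A| ^ 2 < 2 * g] times, which leaves the [2 * g] that the embedding needs. *)
Lemma matching_cycle (V A : finType) (H : rel V) (P : V -> A) (Rr : rel A)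
    (L E Q g m : nat) (rt : A) (M : {set A * A}) :
  irreflexive H -> symmetric H -> symmetric Rr -> (forall a, #|cell P a| = L) ->
  0 < L -> 2 <= Q -> L * Q <= E * g ->
  (forall a b (X Y : {set V}), Rr a b -> X \subset cell P a ->
    Y \subset cell P b -> L <= E * #|X| -> L <= E * #|Y| -> #|X| * #|Y| <= Q * ecount H X Y) ->
  4 * g <= L -> #|A| ^ 2 < g -> #|A| ^ 2 <= m -> 2 <= m ->
  matching M -> (forall p, p \in M -> Rr p.1 p.2 /\ connect Rr rt p.1) ->
  m <= #|M| * ((L - 4 * g)./2) -> has_cycle H (2 * m).
Proof.
move=> Hirr Hsym Rsym cP L0 Q2 gE dense g4 Ag Am m2 mM hM mL.
have hD p : p \in enum M -> Rr p.1 p.2 /\ connect Rr rt p.1 by rewrite mem_enum; apply: hM.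
have [B BM hB] := excursions Rsym hD.
have sD : size (enum M) = #|M| by rewrite -cardE.
rewrite sD in BM hB.
have MA := card_matching mM.
have MA2 : #|M| * #|A| <= #|A| ^ 2 by rewrite -mulnn leq_mul2r MA orbT.
have [|f fM fs] := @spread _ (enum M) ((L - 4 * g)./2) (m - B) (enum_uniq _).
  by rewrite sD; apply: leq_trans mL; exact: leq_subr.
have [w [pw lw sw cw]] := hB f.
have Bm : B <= m by apply: leq_trans BM (leq_trans MA2 Am).
rewrite fs subnKC // in sw.
have cnt c : count_mem c w <= 2 * #|A| ^ 2 + 2 * ((L - 4 * g)./2).
  apply: leq_trans (cw c) _; apply: leq_add; last exact: matching_count mM fM.
  by rewrite -mulnA leq_mul2l /= mulnC.
(* The closed walk from [rt] is taken apart at both ends to expose its first step [d] and the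
   cluster [b] from which it returns to [rt]. *)
case/lastP: w pw lw sw cw cnt => [|w x] pw lw sw cw cnt; first by move: sw m2; case: (m).
rewrite last_rcons in lw; rewrite lw in pw cnt sw.
case: w pw sw cnt {cw} => [|d w] pw sw cnt; first by move: sw m2 => /=; lia.
case/lastP: w pw sw cnt => [|s b] pw sw cnt; first by move: sw m2 => /=; lia.
move: pw; rewrite rcons_path => /andP[pw /=]; rewrite last_rcons => bR.
have -> : 2 * m = size s + 3 by move: sw; rewrite /= !size_rcons => <-; rewrite addn3.
apply: (closed_walk_cycle Hirr Hsym Rsym cP L0 Q2 gE dense pw bR) => [|c].
  by apply: leq_trans g4; rewrite leq_mul2r orbT.
have := cnt c; rewrite /= -!cats1 !count_cat /=.
have : 2 * (L - 4 * g)./2 <= L - 4 * g by rewrite mul2n -{2}(odd_double_half (L - 4 * g)) leq_addl.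
move: (2 * (L - 4 * g)./2) (#|A| ^ 2) (count _ s) Ag g4 => y z t; clear.
by case: (rt == c); case: (d == c); case: (b == c) => /=; lia.
Qed.

(** * Half-integral covers of graphs without a given even cycle *)

Lemma card_cells (V A : finType) (P : V -> A) L :
  (forall a, #|cell P a| = L) -> #|V| = #|A| * L.
Proof.
move=> cP; rewrite -sum1_card (partition_big P xpredT) //=.
rewrite -sum_nat_const; apply: eq_bigr => a _; rewrite -(cP a) -sum1_card.
by apply: eq_bigl => v; rewrite inE.
Qed.

Lemma ecount_sym (V : finType) (H : rel V) (X Y : {set V}) :
  symmetric H -> ecount H X Y = ecount H Y X.
Proof.
move=> Hs; rewrite /ecount exchange_big /=; apply: eq_bigr => y _.
by apply: eq_bigr => x _; rewrite Hs.
Qed.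

Definition regular_pair (V A : finType) (H : rel V) (P : V -> A) (L E q : nat) (a b : A) :=
  [&& L ^ 2 <= q * ecount H (cell P a) (cell P b), ~~ irregular H P L E q (a, b)
    & ~~ irregular H P L E q (b, a)].

Lemma regular_pair_sym (V A : finType) (H : rel V) (P : V -> A) (L E q : nat) :
  symmetric H -> symmetric (regular_pair H P L E q).
Proof. by move=> Hs a b; rewrite /regular_pair ecount_sym // [X in _ && X]andbC. Qed.

(** Sparse pairs contribute at most [#|V| ^ 2 / q] edges in all, and so do the pairs irregular in
    either of the two orders; hence the 3. *)
Lemma few_irregular_edges (V A : finType) (H : rel V) (P : V -> A) (L E q : nat) :
  (forall a, #|cell P a| = L) ->
  q * #|[set p | irregular H P L E q p]| <= #|A| ^ 2 ->
  q * #|[set p : V * V | H p.1 p.2 && ~~ regular_pair H P L E q (P p.1) (P p.2)]|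
    <= 3 * #|V| ^ 2.
Proof.
move=> cP irr.
have -> : #|[set p : V * V | H p.1 p.2 && ~~ regular_pair H P L E q (P p.1) (P p.2)]| =
    \sum_(ab : A * A | ~~ regular_pair H P L E q ab.1 ab.2)
       ecount H (cell P ab.1) (cell P ab.2).
  rewrite -sum1dep_card.
  rewrite (partition_big (fun p : V * V => (P p.1, P p.2))
    (fun ab => ~~ regular_pair H P L E q ab.1 ab.2)) /=; last by move=> p /andP[].
  apply: eq_bigr => -[a b] /= nr; rewrite /ecount pair_big /= [RHS]big_mkcond [LHS]big_mkcond.
  apply: eq_bigr => -[u v] _ /=; rewrite !inE xpair_eqE.
  case: (P u =P a) => [->|]; rewrite ?andbF //=.
  by case: (P v =P b) => [->|]; rewrite ?andbF //= nr !andbT; case: (H u v).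
have iS : #|[set p : A * A | irregular H P L E q (p.2, p.1)]|
        = #|[set p | irregular H P L E q p]|.
  rewrite -(card_imset (mem [set p | irregular H P L E q p]) (f := fun p : A * A => (p.2, p.1))).
    apply: eq_card => -[a b]; rewrite !inE /=; apply/idP/imsetP => [h|[[c d]]].
      by exists (b, a); rewrite ?inE.
    by rewrite inE => h [-> ->].
  by move=> [a b] [c d] [-> ->].
rewrite big_distrr /=.
apply: (@leq_trans (\sum_(ab : A * A) (L ^ 2 + (irregular H P L E q ab + irregular H P L E q (ab.2, ab.1)) * (q * L ^ 2)))).
  rewrite [leqRHS](bigID (fun ab : A * A => ~~ regular_pair H P L E q ab.1 ab.2)) /=.
  apply: leq_trans (leq_addr _ _); apply: leq_sum => -[a b] /=.
  rewrite /regular_pair; case: (leqP (L ^ 2)) => [_ /=|h _]; last first.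
    by apply: leq_trans (ltnW h) _; exact: leq_addr.
  have h := ecount_le H (cell P a) (cell P b); rewrite !cP mulnn in h.
  move=> irrab; apply: leq_trans (leq_addl _ _).
  apply: leq_trans (_ : q * L ^ 2 <= _); first by rewrite leq_mul2l h orbT.
  rewrite -[leqLHS]mul1n leq_mul2r; apply/orP; right; move: irrab.
  by case: (irregular H P L E q (a, b)); case: (irregular H P L E q (b, a)).
rewrite big_split /= sum_nat_const card_prod -big_distrl /= big_split /=.
have cnt (b : pred (A * A)) : \sum_p (b p : nat) = #|[set p | b p]|.
  by rewrite -sum1dep_card [RHS]big_mkcond; apply: eq_bigr => p _; case: (b p).
rewrite (cnt (irregular H P L E q)) (cnt (fun p => irregular H P L E q (p.2, p.1))) iS.
rewrite (card_cells cP) expnMn; move: irr; set i := #|_|.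
rewrite -!mulnn; move: (L * L) (#|A| * #|A|) => x y h.
have hx : q * i * x <= y * x by rewrite leq_mul2r h orbT.
rewrite (_ : (i + i) * (q * x) = 2 * (q * i * x)); first by lia.
by rewrite addnn -mul2n -!mulnA (mulnCA i).
Qed.

(** The labels [c] are the components of the cluster graph. In each, a matching of the double cover
    with about [2 * m / L] edges would give the cycle, so the cover has about that many clusters at
    most, each with [L] vertices. *)
Theorem cycle_free_cover (q : nat) : 0 < q ->
  exists K M0, 0 < K /\ forall (V : finType) (H : rel V),
  irreflexive H -> symmetric H -> K %| #|V| -> M0 <= #|V| ->
  forall m, M0 <= m -> ~ has_cycle H (2 * m) ->
  exists c w : V -> nat, [/\ forall v, w v <= 2,
     q * #|[set p : V * V | H p.1 p.2 && ~~ ((c p.1 == c p.2) && (2 <= w p.1 + w p.2))]|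
       <= #|V| ^ 2
   & forall l, q * \sum_(v | c v == l) w v <= q * (2 * m) + #|V|].
Proof.
(* The value is [32 * q] times [6 * q]: dense pairs have [Q = 6 * q], and the slack [g], about
   [L / (16 * q)], satisfies [L <= 32 * q * g] after rounding. *)
move=> q0; pose E := 192 * q ^ 2.
have q3 : 0 < 3 * q by lia.
have E0 : 0 < E by rewrite muln_gt0 expn_gt0 q0.
have [K K0 reg] := regularity E0 q3.
(* Cells of size at least [C] give [g > K ^ 2 >= #|A| ^ 2], as the travelling part of the closed
   walk requires. *)
pose C := 16 * q * (K ^ 2 + 1).
exists K, (K * C); split=> // V H Hirr Hsym KV MV m Mm noC.
have C16 : 16 <= C by rewrite /C -mulnA leq_pmulr // muln_gt0 q0 addn1.
have V0 : 0 < #|V| by apply: leq_trans MV; rewrite muln_gt0 K0; lia.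
have [A [P [L [cP L0 A0 AK irr]]]] := reg V H V0 KV.
have cV := card_cells cP.
have CL : C <= L.
  by rewrite -(leq_pmul2l K0) (leq_trans MV) // cV leq_mul2r AK orbT.
have AK2 : #|A| ^ 2 <= K ^ 2 by rewrite leq_exp2r.
pose g := L %/ (16 * q).
have q16 : 0 < 16 * q by lia.
have gL : 16 * q * g <= L by rewrite mulnC leq_trunc_div.
have Lg : L < 16 * q * g.+1 by rewrite mulnC ltn_ceil.
have Kg : K ^ 2 + 1 <= g by rewrite leq_divRL // mulnC.
have gE : L * (6 * q) <= E * g.
  have h : L <= 32 * q * g by apply: leq_trans (ltnW Lg) _; nia.
  rewrite (_ : E * g = 32 * q * g * (6 * q)); last by rewrite /E; lia.
  by rewrite leq_mul2r h orbT.
have g4 : 4 * g <= L by apply: leq_trans gL; rewrite leq_mul2r; lia.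
have KC : K ^ 2 <= K * C by rewrite -mulnn leq_mul2l /C; nia.
pose Rr := regular_pair H P L E (3 * q).
have Rsym : symmetric Rr by exact: regular_pair_sym.
have csym : connect_sym Rr by exact: sym_connect_sym.
have dense a b (X Y : {set V}) : Rr a b -> X \subset cell P a -> Y \subset cell P b ->
    L <= E * #|X| -> L <= E * #|Y| -> #|X| * #|Y| <= 6 * q * ecount H X Y.
  move=> /and3P[d + _] sX sY lX lY; rewrite /irregular /= d /= => /existsPn /(_ X).
  by move=> /existsPn /(_ Y); rewrite sX sY lX lY /= -leqNgt mulnA.
have kon ro := koenig [set p | Rr p.1 p.2 && (fingraph.root Rr p.1 == ro)].
have [XY hXY] : exists XY : A -> {set A} * {set A}, forall ro,
    covers (XY ro).1 (XY ro).2 [set p | Rr p.1 p.2 && (fingraph.root Rr p.1 == ro)] /\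
    (#|(XY ro).1| + #|(XY ro).2|) * ((L - 4 * g)./2) < m /\
    #|(XY ro).1| + #|(XY ro).2| <= #|A|.
  apply: (@fin_all_exists A (fun _ => ({set A} * {set A})%type) (fun ro xy =>
     covers xy.1 xy.2 [set p | Rr p.1 p.2 && (fingraph.root Rr p.1 == ro)] /\
    (#|xy.1| + #|xy.2|) * ((L - 4 * g)./2) < m /\ #|xy.1| + #|xy.2| <= #|A|)) => ro.
  have [M [X [Y [sM mM cXY kXY]]]] := kon ro; exists (X, Y); split=> //=.
  split; last by apply: leq_trans kXY (card_matching mM).
  apply: leq_ltn_trans (leq_mul kXY (leqnn _)) _; rewrite ltnNge; apply/negP => mle.
  apply: noC; apply: (matching_cycle (rt := ro) Hirr Hsym Rsym cP L0 _ gE dense g4 _ _ _ mM _ mle).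
  - by lia.
  - by lia.
  - by apply: leq_trans AK2 (leq_trans KC Mm).
  - by apply: leq_trans Mm; apply: leq_trans (_ : C <= _); [lia|rewrite leq_pmull].
  move=> p /(fintype.subsetP sM); rewrite inE => /andP[pR /eqP <-]; split=> //.
  by rewrite csym connect_root.
(* A cluster has two copies in the double cover, and its doubled weight counts those in the cover.
   An edge of the cluster graph is covered in both orientations, so its ends have total weight at
   least 2. *)
pose w v := let xy := XY (fingraph.root Rr (P v)) in (P v \in xy.1) + (P v \in xy.2).
exists (fun v => enum_rank (fingraph.root Rr (P v)) : nat), w; split.
- by move=> v; rewrite /w; case: (_ \in _); case: (_ \in _).
- have := few_irregular_edges cP irr; rewrite -mulnA leq_pmul2l //.
  apply: leq_trans; rewrite leq_mul2l; apply/orP; right; apply: subset_leq_card.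
  apply/fintype.subsetP => -[u v]; rewrite !inE /= => /andP[-> /=]; apply: contra => uv.
  have uv' : Rr (P u) (P v) := uv; have vu' : Rr (P v) (P u) by rewrite Rsym.
  have ro : fingraph.root Rr (P u) = fingraph.root Rr (P v) by apply/(fingraph.rootP csym); exact: connect1.
  rewrite ro eqxx /= /w ro; have [cov _] := hXY (fingraph.root Rr (P v)).
  have := cov (P u, P v); have := cov (P v, P u); rewrite !inE /= uv' vu' ro eqxx /=.
  by move=> /(_ isT) + /(_ isT); do 4!case: (_ \in _).
move=> l; have [/existsP[ro /eqP rol]|/existsPn h] := boolP [exists ro : A, enum_rank ro == l :> nat];
  last by rewrite big1 // ?muln0 // => v /eqP e; have := h (fingraph.root Rr (P v)); rewrite e eqxx.
have [_ [h1 h2]] := hXY ro.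
have : \sum_(v | enum_rank (fingraph.root Rr (P v)) == l :> nat) w v <= (#|(XY ro).1| + #|(XY ro).2|) * L.
  apply: (@leq_trans (\sum_v ((P v \in (XY ro).1) + (P v \in (XY ro).2)))).
    rewrite [leqRHS](bigID (fun v => enum_rank (fingraph.root Rr (P v)) == l :> nat)) /=.
    apply: leq_trans (leq_addr _ _); apply: leq_sum => v.
    by rewrite -rol => /eqP/val_inj/enum_rank_inj e; rewrite /w e.
  have cnt (Z : {set A}) : \sum_v (P v \in Z : nat) = #|Z| * L.
    rewrite (partition_big P xpredT) //= -sum_nat_const [RHS]big_mkcond /=.
    apply: eq_bigr => a _; rewrite (eq_bigr (fun _ => (a \in Z) : nat)); last by move=> v /eqP ->.
    rewrite sum_nat_const -(cP a) cardsE; by case: (a \in Z); rewrite ?muln0 ?muln1.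
  by rewrite big_split /= !cnt mulnDl.
set s := \sum_(_ | _) _ => hs.
move: h1 h2 hs; set n := _ + _ => h1 h2 hs.
have half : L <= 2 * ((L - 4 * g)./2) + 4 * g + 1.
  have := odd_double_half (L - 4 * g); case: odd => /=; rewrite -mul2n; lia.
have e1 : n * L <= 2 * m + n * (4 * g + 1).
  move: h1 half; move: ((L - 4 * g)./2) => y; clear; nia.
have e2 : q * (n * (4 * g + 1)) <= #|V|.
  rewrite cV mulnCA; apply: leq_mul => //; move: gL CL Kg C16; rewrite /C; nia.
apply: leq_trans (_ : q * (2 * m + n * (4 * g + 1)) <= _).
  by rewrite leq_mul2l (leq_trans hs e1) orbT.
by rewrite mulnDr leq_add2l.
Qed.

(** * Three colours *)

Section Labels.
Variables (V : finType).
Implicit Types (c w : V -> nat) (D : nat).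

Definition class_size c (v : V) : nat := #|[set u | c u == c v]|.

Definition large c D (v : V) : bool := #|V| <= D * class_size c v.

(** Label 0 gathers the vertices of small classes; [large_weight] vanishes there, so label 0 carries
    no load. *)
Definition large_label c D (v : V) : nat := if large c D v then (c v).+1 else 0.

Definition large_weight c w D (v : V) : nat := if large c D v then w v else 0.

Lemma sum_classes_le c (U : seq nat) : uniq U ->
  \sum_(l <- U) #|[set u | c u == l]| <= #|V|.
Proof.
move=> uU; rewrite (eq_bigr (fun l => \sum_u ((c u == l) : nat))); last first.
  by move=> l _; rewrite -sum1dep_card big_mkcond; apply: eq_bigr => u _; case: (_ == _).
rewrite exchange_big /= -sum1_card; apply: leq_sum => u _.
have -> : \sum_(l <- U) (c u == l : nat) = count_mem (c u) U.
  rewrite -sum1_count [RHS]big_mkcond; apply: eq_bigr => l _.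
  by rewrite /= eq_sym; case: (_ == _).
by rewrite count_uniq_mem // leq_b1.
Qed.

Lemma large_label_code c D : 0 < #|V| ->
  exists code : V -> 'I_D.+1, forall u v, code u = code v -> large_label c D u = large_label c D v.
Proof.
move=> V0; pose U := undup [seq c v | v <- enum V & large c D v].
have sumc k : \sum_(l <- U) k = size U * k.
  by rewrite big_const_seq count_predT iter_addn_0 mulnC.
have UD : size U <= D.
  rewrite -(leq_pmul2r V0) -sumc.
  apply: (@leq_trans (\sum_(l <- U) D * #|[set u | c u == l]|)).
    rewrite big_seq [leqRHS]big_seq; apply: leq_sum => l.
    by rewrite mem_undup => /mapP[v]; rewrite mem_filter => /andP[lv _] ->.
  by rewrite -big_distrr /= leq_mul2l sum_classes_le ?undup_uniq ?orbT.
pose W := 0 :: [seq l.+1 | l <- U].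
have inW v : large_label c D v \in W.
  rewrite /large_label inE; case: ifPn => //= lv; apply/mapP; exists (c v) => //.
  by rewrite mem_undup; apply/mapP; exists v; rewrite // mem_filter lv mem_enum.
exists (fun v => inord (index (large_label c D v) W)) => u v /(congr1 (@nat_of_ord _)).
have ix x : index (large_label c D x) W < D.+1.
  by apply: leq_trans (_ : size W <= _); rewrite ?index_mem //= size_map ltnS.
rewrite !inordK ?ix // => e.
by rewrite -(nth_index 0 (inW u)) -(nth_index 0 (inW v)) e.
Qed.

Lemma large_weight_code c w D : (forall v, w v <= 2) ->
  exists code : V -> 'I_3, forall u v, code u = code v -> large_weight c w D u = large_weight c w D v.
Proof.
move=> w2; exists (fun v => inord (large_weight c w D v)) => u v /(congr1 val) /=.
have h x : large_weight c w D x < 3 by rewrite /large_weight; case: ifP => // _; rewrite ltnS.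
by rewrite !inordK ?h.
Qed.

Lemma load_bound_large c w D b (S : {set V}) :
  (forall l, \sum_(v | c v == l) w v <= b) ->
  load_bound S (large_label c D) (large_weight c w D) b.
Proof.
move=> hb [|l].
  rewrite big1 // => v _; rewrite /at_label /large_label /large_weight.
  by case: ifP; rewrite // muln0.
apply: leq_trans (hb l); rewrite big_mkcond [leqRHS]big_mkcond; apply: leq_sum => v _.
rewrite /at_label /large_label /large_weight; case: (v \in S) => //.
by case: ifP => _; rewrite ?eqSS; case: (c v == l); rewrite ?mul1n.
Qed.

Definition medium c D D' (v : V) : bool := large c D' v && ~~ large c D v.

(** In each colour a vertex is medium at no more than one scale, so the sets of medium vertices have
    total size at most [3 * #|V|]. *)
Lemma scale_pigeonhole c1 c2 c3 (D : nat -> nat) (J : nat) : 0 < J ->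
  (forall i j, i <= j -> D i <= D j) ->
  exists2 j, j < J & J * #|[set v | [|| medium c1 (D j) (D j.+1) v,
     medium c2 (D j) (D j.+1) v | medium c3 (D j) (D j.+1) v]]| <= 3 * #|V|.
Proof.
move=> J0 Dm.
have once c v : \sum_(j < J) (medium c (D j) (D j.+1) v : nat) <= 1.
  have [/existsP[j mj]|/existsPn h] := boolP [exists j : 'I_J, medium c (D j) (D j.+1) v];
    last by rewrite big1 // => j _; rewrite (negbTE (h j)).
  rewrite (bigD1 j) //= big1 ?addn0 ?leq_b1 // => k kj.
  apply/eqP; rewrite eqb0; apply/negP => mk; move: mj mk kj.
  have mono a b : a <= b -> large c (D a) v -> large c (D b) v.
    by move=> ab /leq_trans; apply; rewrite leq_mul2r Dm // orbT.
  move=> /andP[j1 j2] /andP[k1 k2] /negP; apply; apply/eqP/val_inj/eqP => /=.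
  rewrite eqn_leq; apply/andP; split; rewrite leqNgt; apply/negP => lt.
    by move/negP: k2; apply; apply: mono j1.
  by move/negP: j2; apply; apply: mono k1.
pose mid j := [set v | [|| medium c1 (D j) (D j.+1) v,
     medium c2 (D j) (D j.+1) v | medium c3 (D j) (D j.+1) v]].
have tot : \sum_(j < J) #|mid j| <= 3 * #|V|.
  apply: (@leq_trans (\sum_(j < J) \sum_v ((medium c1 (D j) (D j.+1) v
      + medium c2 (D j) (D j.+1) v) + medium c3 (D j) (D j.+1) v))).
    apply: leq_sum => j _; rewrite -sum1dep_card big_mkcond; apply: leq_sum => v _.
    by do 3!case: (medium _ _ _ _).
  rewrite exchange_big mulnC -sum_nat_const; apply: leq_sum => v _.
  rewrite !big_split /=; have := once c1 v; have := once c2 v; have := once c3 v.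
  move: (\sum_(_ < _) _) (\sum_(_ < _) _) (\sum_(_ < _) _) => x y z; lia.
have [/existsP[j hj]|/existsPn h] := boolP [exists j : 'I_J, J * #|mid j| <= 3 * #|V|].
  by exists j.
have : J * \sum_(j < J) #|mid j| <= J * (3 * #|V|) by rewrite leq_mul2l tot orbT.
have e : J * (3 * #|V|) = \sum_(j < J) 3 * #|V| by rewrite sum_nat_const card_ord.
rewrite big_distrr e /= leqNgt => /negP[].
rewrite (bigD1 (Ordinal J0)) //= [ltnRHS](bigD1 (Ordinal J0)) //= -addSn leq_add //.
  by have := h (Ordinal J0); rewrite -ltnNge.
by apply: leq_sum => j _; apply: ltnW; have := h j; rewrite -ltnNge.
Qed.

Lemma small_types (T : finType) (t : V -> T) (N : {set V}) n :
  n * #|[set v in N | n * #|[set u in N | t u == t v]| < #|V|]| <= #|T| * #|V|.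
Proof.
set B := [set v in N | _].
rewrite -sum1_card (partition_big t xpredT) //= big_distrr /= -sum_nat_const.
apply: leq_sum => x _.
have [/existsP[v /andP[vB /eqP <-]]|/existsPn h] := boolP [exists v, (v \in B) && (t v == x)].
  move: (vB); rewrite inE => /andP[_ /ltnW]; apply: leq_trans.
  rewrite leq_mul2l sum1dep_card; apply/orP; right; apply: subset_leq_card.
  by apply/fintype.subsetP => u; rewrite !inE => /andP[/andP[-> _] ->].
by rewrite big1 ?muln0 // => v vB; have := h v; rewrite vB.
Qed.

Lemma few_small_pairs c D :
  D * #|[set p : V * V | (c p.1 == c p.2) && ~~ large c D p.1]| <= #|V| ^ 2.
Proof.
rewrite -sum1dep_card -(pair_big_dep xpredT (fun u v => (c u == c v) && ~~ large c D u)
  (fun _ _ => 1)) /= big_distrr /= -mulnn -sum_nat_const; apply: leq_sum => u _.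
have [lu|nl] := boolP (large c D u); first by rewrite big_pred0 ?muln0 // => v; rewrite andbF.
apply: ltnW; move: nl; rewrite -ltnNge; apply: leq_ltn_trans.
rewrite leq_mul2l; apply/orP; right; rewrite sum1dep_card; apply: subset_leq_card.
by apply/fintype.subsetP => v; rewrite !inE andbT eq_sym.
Qed.
End Labels.

Definition quasirandom (V : finType) (G : rel V) (C h : nat) :=
  forall X Y : {set V}, [disjoint X & Y] -> #|V| <= h * #|X| -> #|V| <= h * #|Y| ->
  #|X| * #|Y| <= C * ecount G X Y.

Lemma ecount_card (V : finType) (G : rel V) (X Y : {set V}) :
  ecount G X Y = #|[set p : V * V | [&& p.1 \in X, p.2 \in Y & G p.1 p.2]]|.
Proof.
rewrite /ecount pair_big /= -sum1dep_card big_mkcond [RHS]big_mkcond.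
by apply: eq_bigr => -[u v] _ /=; case: (u \in X) (v \in Y) (G u v) => [] [] [].
Qed.

Definition uncovered (V : finType) (H : rel V) (c w : V -> nat) : {set V * V} :=
  [set p : V * V | H p.1 p.2 && ~~ ((c p.1 == c p.2) && (2 <= w p.1 + w p.2))].

Definition small_pairs (V : finType) (c : V -> nat) D : {set V * V} :=
  [set p : V * V | (c p.1 == c p.2) && ~~ large c D p.1].

Lemma class_size_eq (V : finType) (c : V -> nat) u v : c u = c v -> class_size c u = class_size c v.
Proof. by move=> e; rewrite /class_size e. Qed.

(** A covered edge lies inside one class. If that class is large at scale [D], the types of its ends
    are compatible; if not, then [u] not being medium makes the class small even at scale [D']. *)
Lemma covered_or_small (V : finType) (H : rel V) (c w : V -> nat) D D' u v u0 v0 :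
  H u v -> ~~ medium c D D' u ->
  large_label c D u = large_label c D u0 -> large_label c D v = large_label c D v0 ->
  large_weight c w D u = large_weight c w D u0 -> large_weight c w D v = large_weight c w D v0 ->
  ~~ ((large_label c D u0 == large_label c D v0) &&
      (2 <= large_weight c w D u0 + large_weight c w D v0)) ->
  ((u, v) \in uncovered H c w) || ((u, v) \in small_pairs c D').
Proof.
move=> Huv nm <- <- <- <-; rewrite !inE /= Huv /=.
have [/andP[/eqP cuv wuv]|//] := boolP ((c u == c v) && (2 <= w u + w v)).
rewrite cuv eqxx /=; apply: contra => lu'.
have lu : large c D u by move: nm; rewrite /medium lu' negbK.
have lv : large c D v by move: lu; rewrite /large (class_size_eq cuv).
by rewrite /large_label /large_weight lu lv cuv eqxx.
Qed.

Section OneScale.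
Variables (V : finType) (G H1 H2 H3 : rel V) (c1 c2 c3 w1 w2 w3 : V -> nat).
Variables (C h D D' s : nat).
Hypothesis s0 : 0 < s.
Hypothesis qr : quasirandom G C h.
Hypothesis GH : forall u v, G u v -> [|| H1 u v, H2 u v | H3 u v].
Hypothesis wle1 : forall v, w1 v <= 2.
Hypothesis wle2 : forall v, w2 v <= 2.
Hypothesis wle3 : forall v, w3 v <= 2.

Let ntypes := (D.+1 * 3) * (D.+1 * 3) * (D.+1 * 3).
Let h0 := s * ntypes.
Hypothesis hh : 4 * h0 <= h.
Hypothesis Vh : 4 * h0 <= #|V|.
Let Z := 7 * C * (4 * h0) ^ 2.
Hypothesis ZD : Z <= D'.
Hypothesis unc1 : Z * #|uncovered H1 c1 w1| <= #|V| ^ 2.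
Hypothesis unc2 : Z * #|uncovered H2 c2 w2| <= #|V| ^ 2.
Hypothesis unc3 : Z * #|uncovered H3 c3 w3| <= #|V| ^ 2.

Let mid : {set V} := [set v | [|| medium c1 D D' v, medium c2 D D' v | medium c3 D D' v]].

(** Medium vertices and rare types are discarded. Between two incompatible types that remain, every
    edge of [G] would be uncovered or in a small class in some colour: six sets of at most
    [#|V| ^ 2 / Z] pairs, whereas quasirandomness yields at least [7 * #|V| ^ 2 / Z] edges. *)
Lemma one_scale_adjacent : 0 < C -> exists S : {set V},
  jointly_adjacent S (large_label c1 D) (large_label c2 D) (large_label c3 D)
    (large_weight c1 w1 D) (large_weight c2 w2 D) (large_weight c3 w3 D) /\
  s * #|V| <= s * #|S| + s * #|mid| + #|V|.
Proof.
move=> C0; have nt0 : 0 < ntypes by rewrite !muln_gt0.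
have h00 : 0 < h0 by rewrite muln_gt0 s0.
have V0 : 0 < #|V| by apply: leq_trans Vh; rewrite muln_gt0.
have [k1 hk1] := large_label_code c1 D V0; have [k2 hk2] := large_label_code c2 D V0.
have [k3 hk3] := large_label_code c3 D V0.
have [l1 hl1] := large_weight_code c1 D wle1; have [l2 hl2] := large_weight_code c2 D wle2.
have [l3 hl3] := large_weight_code c3 D wle3.
pose t v := ((k1 v, l1 v), (k2 v, l2 v), (k3 v, l3 v)).
pose N := ~: mid; pose cls v := [set u in N | t u == t v].
pose B := [set v in N | h0 * #|cls v| < #|V|].
have sB : s * #|B| <= #|V|.
  have := small_types t N h0; rewrite -/B !card_prod !card_ord -/ntypes.
  by rewrite /h0 mulnAC mulnC leq_pmul2l.
exists (N :\: B); split; last first.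
  have e1 : #|N :\: B| + #|B| = #|N|.
    rewrite cardsD (finset.setIidPr _) ?subnK ?subset_leq_card //;
    by apply/fintype.subsetP => v; rewrite inE => /andP[].
  have e2 : #|mid| + #|N| = #|V| by rewrite cardsC.
  have -> : s * #|V| = s * #|N :\: B| + s * #|mid| + s * #|B|.
    by rewrite -e2 -e1 !mulnDr; lia.
  by rewrite leq_add2l.
move=> u0 v0 u0S v0S; apply: contraT; rewrite !negb_or => /and3P[n1 n2 n3].
pose n := #|V| %/ (4 * h0) + 1.
have nV : #|V| <= 4 * h0 * n by rewrite /n addn1 mulnC; apply: ltnW; rewrite ltn_ceil // muln_gt0 h00.
have ncls v : v \in N :\: B -> 2 * n <= #|cls v|.
  rewrite inE => /andP[+ vN]; rewrite inE vN -leqNgt => hv.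
  rewrite -(leq_pmul2l h00); apply: leq_trans hv.
  have := leq_trunc_div #|V| (4 * h0); rewrite /n mulnDr muln1.
  move: (#|V| %/ _) Vh; move: (h0) (#|V|) => a b x; clear; lia.
(* Since a surviving type has at least [2 * n] vertices, [X] and [Y] can be taken disjoint even when
   the two types coincide. *)
have [X sX cX] : exists2 X : {set V}, X \subset cls u0 & #|X| = n.
  by apply: exists_subset_card; apply: leq_trans (ncls _ u0S); rewrite leq_pmull.
have [Y sY cY] : exists2 Y : {set V}, Y \subset cls v0 :\: X & #|Y| = n.
  apply: exists_subset_card; rewrite cardsD.
  have := subset_leq_card (finset.subsetIr (cls v0) X); have := ncls _ v0S.
  by rewrite cX; move: (#|_ :&: _|) (#|cls v0|) (n) => a b d; clear; lia.
have dXY : [disjoint X & Y].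
  rewrite disjoint_sym finset.disjoints_subset; apply: (fintype.subset_trans sY).
  by apply/fintype.subsetP => v; rewrite !inE => /andP[].
have hn : #|V| <= h * n by apply: leq_trans nV _; rewrite leq_mul2r hh orbT.
have := qr dXY; rewrite cX cY => /(_ hn hn) e.
have bound : ecount G X Y <= #|uncovered H1 c1 w1| + #|uncovered H2 c2 w2|
    + #|uncovered H3 c3 w3| + #|small_pairs c1 D'| + #|small_pairs c2 D'| + #|small_pairs c3 D'|.
  have cup (P Q : {set V * V}) n1' : #|P| <= n1' -> #|P :|: Q| <= n1' + #|Q|.
    by move=> hP; apply: leq_trans (leq_card_setU _ _) _; rewrite leq_add2r.
  rewrite ecount_card; apply: (@leq_trans #|uncovered H1 c1 w1 :|: uncovered H2 c2 w2
    :|: uncovered H3 c3 w3 :|: small_pairs c1 D' :|: small_pairs c2 D' :|: small_pairs c3 D'|);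
    last by do 5!apply: (@cup _ _ _).
  apply: subset_leq_card; apply/fintype.subsetP => -[x y]; rewrite inE /= => /and3P[xX yY Gxy].
  have := fintype.subsetP sX _ xX; rewrite inE => /andP[xN /eqP xt].
  have xm : ~~ [|| medium c1 D D' x, medium c2 D D' x | medium c3 D D' x] by move: xN; rewrite !inE.
  have := fintype.subsetP sY _ yY; rewrite inE => /andP[_]; rewrite inE => /andP[_ /eqP yt].
  move: xt yt; rewrite /t => -[xk1 xl1 xk2 xl2 xk3 xl3] [yk1 yl1 yk2 yl2 yk3 yl3].
  move: xm; rewrite !negb_or => /and3P[m1 m2 m3].
  rewrite !(finset.in_setU).
  case/or3P: (GH Gxy) => Hxy.
  - have := covered_or_small Hxy m1 (hk1 _ _ xk1) (hk1 _ _ yk1) (hl1 _ _ xl1) (hl1 _ _ yl1) n1.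
    by case/orP => ->; rewrite ?orbT.
  - have := covered_or_small Hxy m2 (hk2 _ _ xk2) (hk2 _ _ yk2) (hl2 _ _ xl2) (hl2 _ _ yl2) n2.
    by case/orP => ->; rewrite ?orbT.
  have := covered_or_small Hxy m3 (hk3 _ _ xk3) (hk3 _ _ yk3) (hl3 _ _ xl3) (hl3 _ _ yl3) n3.
  by case/orP => ->; rewrite ?orbT.
have sp (c : V -> nat) : Z * #|small_pairs c D'| <= #|V| ^ 2.
  by apply: leq_trans _ (few_small_pairs c D'); rewrite leq_mul2r ZD orbT.
have := sp c1; have := sp c2; have := sp c3 => p3 p2 p1.
have Zb : Z * ecount G X Y <= 6 * #|V| ^ 2.
  apply: leq_trans (leq_mul (leqnn Z) bound) _; rewrite !mulnDr.
  move: unc1 unc2 unc3 p1 p2 p3; move: (Z * _) (Z * _) (Z * _) (Z * _) (Z * _) (Z * _) (#|V| ^ 2).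
  by clear; lia.
have n0 : 0 < n by rewrite /n addn1.
have V2 : #|V| ^ 2 <= (4 * h0) ^ 2 * n ^ 2 by rewrite -expnMn leq_exp2r.
have big1 : Z * (n * n) <= C * (6 * #|V| ^ 2).
  apply: leq_trans (leq_mul (leqnn Z) e) _; rewrite mulnCA; exact: leq_mul.
have big2 : C * (6 * #|V| ^ 2) <= 6 * C * ((4 * h0) ^ 2 * n ^ 2).
  by rewrite mulnCA mulnA leq_mul2l V2 orbT.
have pos : 0 < C * ((4 * h0) ^ 2 * n ^ 2).
  rewrite muln_gt0 C0; apply: (@leq_mul 1 1); rewrite expn_gt0 ?n0 //.
  by rewrite muln_gt0 h00.
have eZ : Z * (n * n) = 7 * (C * ((4 * h0) ^ 2 * n ^ 2)) by rewrite /Z mulnn !mulnA.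
have := leq_trans big1 big2; rewrite eZ -(mulnA 6).
by move: pos; move: (C * _) => x; clear; lia.
Qed.

Lemma one_scale_extremal b1 b2 b3 : 0 < C ->
  (forall l, \sum_(v | c1 v == l) w1 v <= b1) ->
  (forall l, \sum_(v | c2 v == l) w2 v <= b2) ->
  (forall l, \sum_(v | c3 v == l) w3 v <= b3) ->
  2 * s * #|V| <= s * (b1 + b2 + b3 + maxn b1 (maxn b2 b3)) + 2 * s * #|mid| + 2 * #|V|.
Proof.
move=> C0 B1 B2 B3; have [S [jS cS]] := one_scale_adjacent C0.
have := jointly_adjacent_extremal jS (@load_bound_large V c1 w1 D b1 S B1)
  (@load_bound_large V c2 w2 D b2 S B2) (@load_bound_large V c3 w3 D b3 S B3).
set b := b1 + b2 + b3 + _ => hb.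
have hs : s * (2 * #|S|) <= s * b by rewrite leq_mul2l hb orbT.
move: cS hs; clearbody b; move: (#|V|) (#|S|) (#|mid|) (s) => x y z a; clear; lia.
Qed.
End OneScale.

Definition type_count (s D : nat) : nat := 4 * (s * ((D.+1 * 3) * (D.+1 * 3) * (D.+1 * 3))).

(** The increment is the constant [Z] of the previous scale, so that consecutive scales satisfy
    [Z <= D']. *)
Fixpoint scale (C s j : nat) : nat :=
  if j is j'.+1 then scale C s j' + 7 * C * type_count s (scale C s j') ^ 2 else 1.

Lemma scale_mono C s i j : i <= j -> scale C s i <= scale C s j.
Proof. by move=> /subnK <-; elim: (j - i) => // k IH; rewrite addSn (leq_trans IH) ?leq_addr. Qed.

Lemma type_count_mono s D D' : D <= D' -> type_count s D <= type_count s D'.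
Proof. by move=> h; rewrite /type_count !leq_mul. Qed.

Theorem three_colour_cycles (C q : nat) : 0 < C -> 0 < q ->
  exists K M0 h, [/\ 0 < K, 0 < h & forall (V : finType) (G H1 H2 H3 : rel V),
  quasirandom G C h -> (forall u v, G u v -> [|| H1 u v, H2 u v | H3 u v]) ->
  irreflexive H1 -> irreflexive H2 -> irreflexive H3 ->
  symmetric H1 -> symmetric H2 -> symmetric H3 ->
  K %| #|V| -> M0 <= #|V| -> forall m1 m2 m3, M0 <= m1 -> M0 <= m2 -> M0 <= m3 ->
  ~ has_cycle H1 (2 * m1) -> ~ has_cycle H2 (2 * m2) -> ~ has_cycle H3 (2 * m3) ->
  q * #|V| <= q * (m1 + m2 + m3 + maxn m1 (maxn m2 m3)) + #|V|].
Proof.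
(* The error [#|V| / q] is split into three equal parts: rare types cost [#|V| / s], medium vertices
   [3 * #|V| / J], and the excess in the loads the rest. *)
move=> C0 q0; pose s := 3 * q; pose J := 9 * q; pose D := scale C s.
have s0 : 0 < s by rewrite muln_gt0.
have J0 : 0 < J by rewrite muln_gt0.
(* The first term keeps the excess [x] of each load below [#|V| / (6 * q)]; the second dominates [Z]
   at whichever scale is selected. *)
pose q' := 6 * q + D J.
have q'0 : 0 < q' by rewrite addn_gt0 muln_gt0 q0.
have [K [M0 [K0 cov]]] := cycle_free_cover q'0.
pose h := type_count s (D J).
exists K, (M0 + h), h; split=> //; first by rewrite /h /type_count !muln_gt0 q0.
move=> V G H1 H2 H3 qr GH i1 i2 i3 s1 s2 s3 KV MV m1 m2 m3 M1 M2 M3 n1 n2 n3.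
have MV0 := leq_trans (leq_addr h M0) MV.
have [c1 [w1 [ww1 u1 l1]]] := cov V H1 i1 s1 KV MV0 m1 (leq_trans (leq_addr h M0) M1) n1.
have [c2 [w2 [ww2 u2 l2]]] := cov V H2 i2 s2 KV MV0 m2 (leq_trans (leq_addr h M0) M2) n2.
have [c3 [w3 [ww3 u3 l3]]] := cov V H3 i3 s3 KV MV0 m3 (leq_trans (leq_addr h M0) M3) n3.
have [j jJ midj] := scale_pigeonhole c1 c2 c3 (D := D) J0 (@scale_mono C s).
have tj : type_count s (D j) <= h by apply: type_count_mono; apply: scale_mono; exact: ltnW.
have Zj : 7 * C * type_count s (D j) ^ 2 <= D j.+1 by exact: leq_addl.
have Zq : 7 * C * type_count s (D j) ^ 2 <= q'.
  by apply: leq_trans Zj (leq_trans (scale_mono C s jJ) _); exact: leq_addl.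
pose x := #|V| %/ q'.
have load (c w : V -> nat) m :
    (forall l, q' * \sum_(v | c v == l) w v <= q' * (2 * m) + #|V|) ->
    forall l, \sum_(v | c v == l) w v <= 2 * m + x.
  by move=> hl l; rewrite -leq_subLR leq_divRL // mulnC mulnBr leq_subLR.
have unc (U : {set V * V}) : q' * #|U| <= #|V| ^ 2 ->
    7 * C * type_count s (D j) ^ 2 * #|U| <= #|V| ^ 2.
  by apply: leq_trans; rewrite leq_mul2r Zq orbT.
have := @one_scale_extremal V G H1 H2 H3 c1 c2 c3 w1 w2 w3 C h (D j) (D j.+1) s s0 qr GH
  ww1 ww2 ww3 tj (leq_trans tj (leq_trans (leq_addl _ _) MV)) Zj (unc _ u1) (unc _ u2) (unc _ u3)
  _ _ _ C0 (load _ _ _ l1) (load _ _ _ l2) (load _ _ _ l3).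
have xq : 6 * q * x <= #|V|.
  apply: leq_trans (leq_trunc_div #|V| q'); rewrite mulnC leq_mul2l; apply/orP; right; exact: leq_addr.
move: midj xq; rewrite /J /s.
set mid := #|_|; move: (#|V|) (x) (mid) => v y z; clear => hz hy.
have -> : 2 * m1 + y + (2 * m2 + y) + (2 * m3 + y) +
  maxn (2 * m1 + y) (maxn (2 * m2 + y) (2 * m3 + y)) =
  2 * (m1 + m2 + m3 + maxn m1 (maxn m2 m3)) + 4 * y by lia.
move: (m1 + m2 + m3 + _) => M; move: hz hy; lia.
Qed.

(** * The random graph *)

Section RandomGraph.
Variables (R : realType) (p : R).
Hypothesis p0 : (0 < p)%R.
Hypothesis p1 : (p <= 1)%R.
Variable N : nat.
Implicit Types E : {set {set 'I_N}}.

Lemma gnp_weight_ge0 E : (0 <= gnp_weight p E)%R.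
Proof. by apply: prodr_ge0 => e _; move: p0 p1; case: ifP => _; lra. Qed.

Lemma gnp_prob_mono (A B : sgraph -> bool) : (forall E, A (mk_sgraph E) -> B (mk_sgraph E)) ->
  (gnp_prob N p A <= gnp_prob N p B)%R.
Proof.
move=> AB; rewrite /gnp_prob big_mkcondr [leRHS]big_mkcondr; apply: ler_sum => E _.
case: ifP => [/AB ->//|_]; case: ifP => _ //; exact: gnp_weight_ge0.
Qed.

Lemma gnp_prob_le1 (A : sgraph -> bool) : (gnp_prob N p A <= 1)%R.
Proof. by rewrite -(gnp_prob_total N p); apply: gnp_prob_mono. Qed.

Lemma gnp_probC (A : sgraph -> bool) :
  (gnp_prob N p A = 1 - gnp_prob N p (fun F => ~~ A F))%R.
Proof.
rewrite -(gnp_prob_total N p) /gnp_prob.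
rewrite [X in (_ = X - _)%R](bigID (fun E : {set {set 'I_N}} => A (mk_sgraph E))) /=.
rewrite -[LHS](addrK (\sum_(i in powerset (pairs 'I_N) | ~~ A (mk_sgraph i)) gnp_weight p i)%R).
by congr (_ + _ - _)%R; apply: eq_bigl => E; rewrite andbT.
Qed.

(** The expectation of a product of independent factors, each pair in [B] contributing
    [p / 2 + (1 - p)]. *)
Lemma gnp_moment (B : {set {set 'I_N}}) : B \subset pairs 'I_N ->
  (\sum_(E in powerset (pairs 'I_N)) gnp_weight p E * 2^-1 ^+ #|E :&: B|
   = (1 - p / 2) ^+ #|B|)%R.
Proof.
move=> sB.
pose F e : R := (if e \in pairs 'I_N then p * (if e \in B then 2^-1 else 1) else 0)%R.
pose G e : R := (if e \in pairs 'I_N then 1 - p else 1)%R.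
have : (\prod_e (F e + G e) = \sum_(E in {set {set 'I_N}})
    \prod_e (if e \in E then F e else G e))%R by exact: bigA_distr.
have -> : (\prod_e (F e + G e) = (1 - p / 2) ^+ #|B|)%R.
  rewrite -prodr_const [RHS]big_mkcond; apply: eq_bigr => e _; rewrite /F /G.
  have [eB|eB] := boolP (e \in B).
    by rewrite (fintype.subsetP sB _ eB); lra.
  by case: ifP => _; lra.
move=> ->; rewrite [RHS](bigID (fun E : {set {set 'I_N}} => E \subset pairs 'I_N)) /=.
rewrite [X in (_ = _ + X)%R]big1 => [|E /fintype.subsetPn[e eE eN]]; last first.
  by rewrite (bigD1 e) //= eE /F (negbTE eN) mul0r.
rewrite addr0; apply: eq_big => [E|E]; first by rewrite powersetE.
rewrite powersetE => /fintype.subsetP sE.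
have -> : (2^-1 ^+ #|E :&: B| = \prod_(e in pairs 'I_N) (if e \in E :&: B then 2^-1 else 1) :> R)%R.
  rewrite -prodr_const big_mkcond [RHS]big_mkcond; apply: eq_bigr => e _.
  by case: ifPn => [|_]; rewrite ?if_same // !inE => /andP[/sE + _]; rewrite inE => ->.
rewrite /gnp_weight -big_split big_mkcond /=; apply: eq_bigr => e _; rewrite /F /G !inE.
case: ifPn => eN; first by case: (e \in E) => /=; rewrite ?mulr1.
by case: ifP => // /sE; rewrite inE (negbTE eN).
Qed.

(* Markov's inequality for [2^-1 ^+ #|E :&: B|]. *)
Lemma gnp_tail (B : {set {set 'I_N}}) (C0 : nat) : B \subset pairs 'I_N ->
  ((1 - p / 2) ^+ C0 <= 2^-1)%R ->
  (\sum_(E in powerset (pairs 'I_N) | (2 * C0 * #|E :&: B| < #|B|)%N) gnp_weight p E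
    <= (1 - p / 2) ^+ (#|B|./2))%R.
Proof.
move=> sB hC; set th := (1 - p / 2)%R in hC *.
have th0 : (0 < th)%R by move: p0 p1; rewrite /th; lra.
have th1 : (th <= 1)%R by move: p0 p1; rewrite /th; lra.
rewrite -(ler_pM2r (exprn_gt0 (#|B|./2) th0)) mulr_suml.
apply: (@le_trans _ _ (th ^+ #|B|)%R); last first.
  rewrite -exprD; apply: ler_wiXn2l => //; first exact: ltW.
  by rewrite addnn -[leqRHS](odd_double_half #|B|) leq_addl.
rewrite -(gnp_moment sB) big_mkcondr; apply: ler_sum => E _.
case: ifP => [hE|_]; last by rewrite mulr_ge0 ?gnp_weight_ge0 ?exprn_ge0.
apply: ler_wpM2l; first exact: gnp_weight_ge0.
apply: (@le_trans _ _ (th ^+ (C0 * #|E :&: B|))%R).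
  apply: ler_wiXn2l => //; first exact: ltW.
  by move: hE; rewrite -mulnA; move: (C0 * _) (#|B|) => x y; lia.
by rewrite exprM lerXn2r ?nnegrE ?exprn_ge0 ?invr_ge0 // ltW.
Qed.

Definition edge_rel E : rel 'I_N := fun u v => [set u; v] \in E.

Definition cross_pairs (X Y : {set 'I_N}) : {set {set 'I_N}} :=
  [set [set z.1; z.2] | z in finset.setX X Y].

Lemma cross_pairs_inj (X Y : {set 'I_N}) : [disjoint X & Y] ->
  {in finset.setX X Y &, injective (fun z : 'I_N * 'I_N => [set z.1; z.2])}.
Proof.
move=> dXY [x y] [x' y']; rewrite !inE /= => /andP[xX yY] /andP[x'X y'Y] e.
have nd a : a \in X -> a \in Y -> False by move=> aX; rewrite (disjointFr dXY aX).
have := set21 x y; have := set22 x y; rewrite e !inE.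
move=> /orP[/eqP ey|/eqP ey] /orP[/eqP ex|/eqP ex]; last 1 first.
- by case: (nd x xX); rewrite ex.
- by case: (nd x' x'X); rewrite -ey.
- by case: (nd x' x'X); rewrite -ey.
by rewrite ex ey.
Qed.

Lemma cross_pairs_sub (X Y : {set 'I_N}) : [disjoint X & Y] ->
  cross_pairs X Y \subset pairs 'I_N.
Proof.
move=> dXY; apply/fintype.subsetP => e /imsetP[[x y]]; rewrite inE /= => /andP[xX yY] ->.
rewrite inE cards2; case: (x =P y) => // exy.
by rewrite exy (disjointFl dXY yY) in xX.
Qed.

Lemma card_cross_pairs (X Y : {set 'I_N}) : [disjoint X & Y] ->
  #|cross_pairs X Y| = #|X| * #|Y|.
Proof. by move=> dXY; rewrite card_in_imset ?cardsX //; exact: cross_pairs_inj. Qed.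

Lemma ecount_cross (X Y : {set 'I_N}) E : [disjoint X & Y] ->
  ecount (edge_rel E) X Y = #|E :&: cross_pairs X Y|.
Proof.
move=> dXY; rewrite ecount_card.
rewrite -(card_in_imset (f := fun z : 'I_N * 'I_N => [set z.1; z.2])); last first.
  move=> z z'; rewrite !inE => /and3P[a b _] /and3P[c d _].
  by apply: (cross_pairs_inj dXY); rewrite inE ?a ?b ?c ?d.
congr #|pred_of_set _|; apply/setP => e; rewrite inE; apply/imsetP/andP.
  move=> [z]; rewrite inE => /and3P[zX zY zE] ->; split=> //.
  by apply/imsetP; exists z => //; rewrite inE zX zY.
move=> [eE /imsetP[z]]; rewrite inE => /andP[zX zY] ee; exists z => //.
by rewrite inE zX zY -[edge_rel E _ _]/([set z.1; z.2] \in E) -ee.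
Qed.
End RandomGraph.

Definition quasirandom_graph (C h : nat) (F : sgraph) : bool :=
  [forall X : {set vert F}, forall Y : {set vert F},
    [&& [disjoint X & Y], nvert F <= h * #|X| & nvert F <= h * #|Y|] ==>
    (#|X| * #|Y| <= C * ecount (edge_rel (edges F)) X Y)].

Lemma quasirandom_graphP (C h : nat) (F : sgraph) :
  quasirandom_graph C h F -> quasirandom (edge_rel (edges F)) C h.
Proof.
move=> /forallP qF X Y d; rewrite card_ord => hX hY.
by have /forallP /(_ Y) /implyP := qF X; apply; rewrite d hX hY.
Qed.

Lemma pow_small (R : realType) (th e : R) : (0 <= th)%R -> (th < 1)%R -> (0 < e)%R ->
  exists n0, forall n, n0 <= n -> (th ^+ n <= e)%R.
Proof.
move=> t0 t1 e0; have thn : (`|th| < 1)%R by rewrite ger0_norm.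
have /cvgrPdist_le /(_ e e0) := cvg_expr thn.
move=> [n0 _ hn0]; exists n0 => n /hn0 /=.
by rewrite sub0r normrN ger0_norm ?exprn_ge0.
Qed.

(** A union bound over the [4 ^ N] pairs of sets, each failing with probability at most [8 ^ - N]
    because [#|X| * #|Y|] is quadratic in [N]. The constant [C] is fixed before [h], since [h] will
    be chosen in terms of [C]. *)
Lemma quasirandom_prob (R : realType) (p : R) : (0 < p)%R -> (p <= 1)%R ->
  exists2 C, 0 < C & forall h, 0 < h -> exists N0, forall N, N0 <= N ->
  (1 - 2^-1 ^+ N <= gnp_prob N p (quasirandom_graph C h))%R.
Proof.
move=> p0 p1; set th := (1 - p / 2)%R.
have th0 : (0 < th)%R by rewrite /th; lra.
have th1 : (th < 1)%R by rewrite /th; lra.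
have half0 : (0 < 2^-1 :> R)%R by lra.
have eighth0 : (0 < 8^-1 :> R)%R by lra.
have [C1 /(_ C1.+1 (leqnSn _)) hC1] := pow_small (ltW th0) th1 half0.
have [t0 /(_ t0 (leqnn _)) ht] := pow_small (ltW th0) th1 eighth0.
exists (2 * C1.+1) => // h h0; exists (2 * t0 * h ^ 2 + 1) => N hN.
have N0 : 0 < N by apply: leq_trans hN; rewrite addn1.
rewrite gnp_probC lerB //.
pose ok (XY : {set 'I_N} * {set 'I_N}) :=
  [&& [disjoint XY.1 & XY.2], N <= h * #|XY.1| & N <= h * #|XY.2|].
pose bad (XY : {set 'I_N} * {set 'I_N}) (E : {set {set 'I_N}}) :=
  2 * C1.+1 * #|E :&: cross_pairs XY.1 XY.2| < #|cross_pairs XY.1 XY.2|.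
have each XY : ok XY -> (\sum_(E in powerset (pairs 'I_N) | bad XY E) gnp_weight p E
    <= 8^-1 ^+ N)%R.
  case: XY => X Y /and3P[/= dXY hX hY].
  apply: le_trans (gnp_tail p0 p1 (cross_pairs_sub dXY) hC1) _.
  have hb : 2 * (t0 * N) <= #|X| * #|Y|.
    have h2 : 0 < h ^ 2 by rewrite expn_gt0 h0.
    rewrite -(leq_pmul2l h2).
    apply: (@leq_trans (N * N)).
      rewrite [leqLHS](_ : _ = 2 * t0 * h ^ 2 * N); last by lia.
      by rewrite leq_mul2r (leq_trans _ hN) ?leq_addr ?orbT.
    by apply: leq_trans (leq_mul hX hY) _; rewrite mulnACA mulnn.
  apply: (@le_trans _ _ (th ^+ (t0 * N))%R); last first.
    by rewrite exprM lerXn2r ?nnegrE ?exprn_ge0 ?invr_ge0 // ltW.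
  apply: ler_wiXn2l; [exact: ltW|exact: ltW|].
  by rewrite card_cross_pairs // geq_half_double -mul2n.
apply: (@le_trans _ _ (\sum_(XY | ok XY) \sum_(E in powerset (pairs 'I_N) | bad XY E) gnp_weight p E)%R).
  rewrite (exchange_big_dep (fun E => E \in powerset (pairs 'I_N))) /=; last by move=> XY E _ /andP[].
  rewrite /gnp_prob big_mkcondr; apply: ler_sum => E EP.
  case: ifPn => [|_]; last by apply: sumr_ge0 => XY _; exact: gnp_weight_ge0.
  rewrite negb_forall => /existsP[X]; rewrite negb_forall => /existsP[Y].
  rewrite negb_imply -ltnNge => /andP[oXY hbad].
  rewrite (bigD1 (X, Y)) /=; last first.
    rewrite /ok oXY /= EP /bad /=; case/and3P: oXY => dXY _ _.
    have -> : E = edges (mk_sgraph E).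
      by rewrite /mk_sgraph /=; apply/esym/finset.setIidPl; rewrite powersetE in EP.
    by rewrite -ecount_cross // card_cross_pairs.
  by rewrite lerDl; apply: sumr_ge0 => XY _; exact: gnp_weight_ge0.
apply: (@le_trans _ _ (\sum_(XY : {set 'I_N} * {set 'I_N}) 8^-1 ^+ N)%R).
  rewrite [leRHS](bigID ok) /= -[leLHS]addr0 lerD //; first exact: ler_sum.
  by apply: sumr_ge0 => XY _; rewrite exprn_ge0 // invr_ge0.
rewrite sumr_const card_prod -[X in (X * X)%N]cardsT -powersetT card_powerset cardsT card_ord.
rewrite -[leLHS]mulr_natl natrM natrX.
rewrite -!exprMn; apply: lerXn2r; rewrite ?nnegrE; lra.
Qed.

(** * From colourings to the asymptotic statement *)

Definition colour_rel (F : sgraph) (k : nat) (c : {set vert F} -> 'I_k) (i : 'I_k) :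
    rel (vert F) :=
  fun u v => ([set u; v] \in edges F) && (c [set u; v] == i).

Lemma colour_rel_sym (F : sgraph) (k : nat) (c : {set vert F} -> 'I_k) i :
  symmetric (colour_rel c i).
Proof. by move=> u v; rewrite /colour_rel finset.setUC. Qed.

Lemma colour_rel_irr (F : sgraph) (k : nat) (c : {set vert F} -> 'I_k) i :
  irreflexive (colour_rel c i).
Proof.
move=> u; apply/negbTE/negP => /andP[/(fintype.subsetP (edges_pairs F)) + _].
by rewrite inE cards2 eqxx.
Qed.

Lemma cycle_nth (T : eqType) (e : rel T) (x0 : T) (w : seq T) (i : nat) :
  cycle e w -> i < size w -> e (nth x0 w i) (nth x0 w (i.+1 %% size w)).
Proof.
case: w => // x q /= /(pathP x0) pth; rewrite ltnS => iq.
have := pth i; rewrite size_rcons ltnS => /(_ iq).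
rewrite -rcons_cons nth_rcons /= ltnS iq.
rewrite nth_rcons; move: iq; rewrite leq_eqVlt => /orP[/eqP ->|iq].
  by rewrite ltnn eqxx modnn.
by rewrite iq modn_small.
Qed.

Lemma cycle_copy (F : sgraph) (k : nat) (c : {set vert F} -> 'I_k) (i : 'I_k) (n : nat) :
  0 < n -> has_cycle (colour_rel c i) n -> has_copy (color_class c i) (cycle_graph n).
Proof.
move=> n0 [w [sw uw cw]].
have [x0 _] : exists x : vert F, x \in w.
  by case: (w) sw n0 => [<-//|x ? _ _]; exists x; rewrite mem_head.
apply/existsP; exists [ffun j : 'I_n => nth x0 w j]; apply/andP; split.
  apply/injectiveP => a b; rewrite !ffunE => /eqP.
  by rewrite nth_uniq ?sw ?ltn_ord // => /eqP/val_inj.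
apply/forallP => e; apply/implyP => /=; rewrite inE => /andP[/imsetP[j _ ->] _].
rewrite imsetU1 imset_set1 !ffunE inE [in X in _ && X]inE.
have := cycle_nth x0 cw (_ : j < size w); rewrite sw => /(_ (ltn_ord j)).
rewrite /colour_rel => /andP[eF ec].
rewrite inE eF ec /=; have := fintype.subsetP (edges_pairs F) _ eF; by rewrite inE.
Qed.

(** Diagonalisation: the hypothesis gives a number of vertices for each precision [j] separately,
    while [aas_gnp] asks for one sequence. For each [n] the best precision up to [n] that can be
    attained is used. *)
Lemma aas_gnp_intro (R : realType) (s p : R) (A : nat -> sgraph -> bool) :
  (0 < p)%R -> (p <= 1)%R ->
  (forall j : nat, exists n0, forall n, n0 <= n -> exists N : nat,
    (`|N%:R - s * n%:R| * j.+1%:R <= n%:R)%R /\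
    (1 - gnp_prob N p (A n) <= j.+1%:R^-1)%R) ->
  aas_gnp s p A.
Proof.
move=> p0 p1 hA.
pose good n N j := (`|N%:R - s * n%:R| * j.+1%:R <= n%:R)%R /\
    (1 - gnp_prob N p (A n) <= j.+1%:R^-1)%R.
have mono n N j k : k <= j -> good n N j -> good n N k.
  move=> kj [h1 h2]; split.
    by apply: le_trans h1; apply: ler_wpM2l => //; rewrite ler_nat.
  by apply: le_trans h2 _; rewrite lef_pV2 ?posrE ?ltr0n // ler_nat.
have best n b : exists N, forall j, j <= b -> (exists N', good n N' j) -> good n N j.
  elim: b => [|b [N hN]].
    have [[N hN]|no] := pselect (exists N', good n N' 0).
      by exists N => j; rewrite leqn0 => /eqP ->.
    by exists 0 => j; rewrite leqn0 => /eqP -> /no.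
  have [[N' hN']|no] := pselect (exists N', good n N' b.+1).
    by exists N' => j jb _; apply: mono hN'.
  exists N => j; rewrite leq_eqVlt => /orP[/eqP -> /no //|]; exact: hN.
(* At [n = 0] the equation [(N n)%:R = (s + e n) * n%:R] forces [N 0 = 0]. *)
have /choice[f hf] : forall n, exists N, (n = 0 -> N = 0) /\
    (0 < n -> forall j, j <= n -> (exists N', good n N' j) -> good n N j).
  by case=> [|n]; first (by exists 0); have [N hN] := best n.+1 n.+1; exists N.
pose e n : R := (if n == 0%N then 0 else (f n)%:R / n%:R - s)%R.
have ev j : exists n1, forall n, n1 <= n -> 0 < n /\ good n (f n) j.
  have [n0 hn0] := hA j; exists (n0 + j + 1) => n hn.
  have n_gt0 : 0 < n by apply: leq_trans hn; rewrite addn1.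
  split=> //; have [_ /(_ n_gt0)] := hf n; apply.
    by apply: leq_trans hn; rewrite -addnA addnCA leq_addr.
  by apply: hn0; apply: leq_trans hn; rewrite -addnA leq_addr.
have arch (eps : R) : (0 < eps)%R -> exists j : nat, (j.+1%:R^-1 < eps)%R.
  move=> eps0; exists (Num.truncn eps^-1); rewrite invf_plt ?posrE ?ltr0n //.
  have v0 : (0 <= eps^-1)%R by rewrite invr_ge0 ltW.
  by have /andP[] := truncn_itv v0.
exists e, f; split.
- apply/cvgrPdist_lt => eps eps0; have [j je] := arch eps eps0.
  have [n1 hn1] := ev j; exists n1 => // n /= /hn1[n_gt0 [h1 _]].
  apply: le_lt_trans je; rewrite sub0r normrN /e gtn_eqF //.
  have nR : (0 < n%:R :> R)%R by rewrite ltr0n.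
  rewrite (_ : (f n)%:R / n%:R - s = ((f n)%:R - s * n%:R) / n%:R)%R; last first.
    by field; rewrite gt_eqF.
  by rewrite normrM normfV (gtr0_norm nR) ler_pdivrMr // ler_pdivlMl ?ltr0n // mulrC.
- move=> n; rewrite /e; case: eqP => [n0|/eqP n0].
    by have [/(_ n0) -> _] := hf n; rewrite n0 mulr0.
  by field; rewrite pnatr_eq0.
apply/cvgrPdist_lt => eps eps0; have [j je] := arch eps eps0.
have [n1 hn1] := ev j; exists n1 => // n /= /hn1[n_gt0 [_ h2]].
by apply: le_lt_trans je; rewrite ger0_norm // subr_ge0 gnp_prob_le1.
Qed.

(* [K] comes from the equal cluster sizes of the regularity lemma; it is bounded, so
   rounding the number of vertices up to a multiple of [K] costs only [o(n)]. *)
Lemma aas_gnp_of_quasirandom (R : realType) (s p : R) (A : nat -> sgraph -> bool) :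
  (0 < p)%R -> (p <= 1)%R -> (0 < s)%R ->
  (forall C q : nat, 0 < C -> 0 < q -> exists K h d n0 : nat, [/\ 0 < K, 0 < h &
    forall n F, n0 <= n -> n0 <= nvert F -> K %| nvert F -> quasirandom_graph C h F ->
    (q%:R * (s * n%:R + d%:R) + (nvert F)%:R < q%:R * (nvert F)%:R)%R -> A n F]) ->
  aas_gnp s p A.
Proof.
move=> p0 p1 s0 hA; apply: aas_gnp_intro => // j.
(* Half of the permitted deviation [1 / (j + 1)] goes to the surplus of vertices, the other half to
   rounding up to a multiple of [K]. *)
pose eps : R := (2 * j.+1%:R)^-1%R.
have jR : (0 < j.+1%:R :> R)%R by rewrite ltr0n.
have eps0 : (0 < eps)%R by rewrite invr_gt0 mulr_gt0.
have [C C0 hC] := quasirandom_prob p0 p1.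
(* With [N >= (s + eps) * n], the surplus [(q - 1) * eps * n] has to exceed [s * n + q * d], and
   [q * d < n] for large [n]. *)
pose q := (Num.truncn ((s + 1) / eps)).+2.
have qe : (s + 1 < (q%:R - 1) * eps)%R.
  rewrite -ltr_pdivrMr // /q -[_.+2]addn1 natrD addrK.
  have v0 : (0 <= (s + 1) / eps)%R by rewrite divr_ge0 // ltW // addr_gt0.
  by have /andP[] := truncn_itv v0.
have q0 : 0 < q by [].
have [K [h [d [n0 [K0 h0 hF]]]]] := hA C q C0 q0.
have [N0 hN0] := hC h h0.
have half0 : (0 <= 2^-1 :> R)%R by lra.
have half1 : (2^-1 < 1 :> R)%R by lra.
have jV : (0 < j.+1%:R^-1 :> R)%R by rewrite invr_gt0.
have [n1 hn1] := pow_small half0 half1 jV.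
pose m := n0 + N0 + n1.
pose n2 := (Num.truncn (m%:R / s)%R + Num.truncn (K.+1%:R / eps)%R + q * d).+1.
exists (n0 + n2) => n hn.
have big (x : R) : (0 <= x)%R -> Num.truncn x < n -> (x <= n%:R)%R.
  by move=> x0; rewrite truncn_lt_nat // => /ltW.
have mn : (m%:R / s <= n%:R)%R.
  apply: big; first by apply: divr_ge0; [exact: ler0n|exact: ltW].
  by move: hn; rewrite /n2; move: (Num.truncn _) (Num.truncn _) (q * d) => x y z; clear; lia.
have Kn : (K.+1%:R / eps <= n%:R)%R.
  apply: big; first by apply: divr_ge0; [exact: ler0n|exact: ltW].
  by move: hn; rewrite /n2; move: (Num.truncn _) (Num.truncn _) (q * d) => x y z; clear; lia.
have dn : q * d < n.
  by move: hn; rewrite /n2; move: (Num.truncn _) (Num.truncn _) (q * d) => x y z; clear; lia.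
have nn0 : n0 <= n by apply: leq_trans hn; exact: leq_addr.
have n_gt0 : 0 < n by apply: leq_trans dn.
have nR : (0 < n%:R :> R)%R by rewrite ltr0n.
rewrite ler_pdivrMr // in mn; rewrite ler_pdivrMr // in Kn.
pose x := ((s + eps) * n%:R)%R.
have x0 : (0 <= x)%R by rewrite mulr_ge0 // ltW // addr_gt0.
have /andP[t1 t2] := truncn_itv x0.
pose N := K * (Num.truncn x %/ K).+1.
have N1 : Num.truncn x < N by rewrite /N mulnC ltn_ceil.
have N2 : N <= Num.truncn x + K by rewrite /N mulnS addnC leq_add2r mulnC leq_trunc_div.
have xN : (x <= N%:R)%R by apply: le_trans (ltW t2) _; rewrite ler_nat.
have Nx : (N%:R <= x + K%:R)%R.
  by apply: (@le_trans _ _ (Num.truncn x + K)%:R%R); rewrite ?ler_nat // natrD lerD2r.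
have mN : m <= N.
  by rewrite -(ler_nat R); apply: le_trans mn (le_trans _ xN); rewrite /x mulrC ler_pM2r // lerDl ltW.
exists N; split.
  have xE : (x = s * n%:R + eps * n%:R)%R by rewrite /x mulrDl.
  have eE : (2 * eps * n%:R * j.+1%:R = n%:R)%R by rewrite /eps; field; rewrite gt_eqF.
  rewrite ger0_norm; last by have := mulr_gt0 eps0 nR; lra.
  rewrite -[leRHS]eE; apply: ler_wpM2r; first exact: ltW.
  have : (K%:R <= K.+1%:R :> R)%R by rewrite ler_nat.
  lra.
rewrite lerBlDr -lerBlDl; apply: le_trans (_ : gnp_prob N p (quasirandom_graph C h) <= _)%R.
  apply: le_trans (hN0 N _).
    by apply: lerB => //; apply: hn1; apply: leq_trans mN; exact: leq_addl.
  by apply: leq_trans mN; rewrite /m addnAC leq_addl.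
apply: gnp_prob_mono => // E qE; apply: hF => //=.
- by apply: leq_trans mN; rewrite /m -addnA leq_addr.
- exact: dvdn_mulr.
rewrite mulrDr -ltrBrDr -[(q%:R * N%:R - _)%R]/(q%:R * N%:R - N%:R)%R.
have h1 : (q%:R * d%:R < n%:R :> R)%R by rewrite -natrM ltr_nat.
have h2 : ((s + 1) * n%:R < (q%:R - 1) * eps * n%:R)%R by rewrite ltr_pM2r.
have q1 : (0 <= q%:R - 1 :> R)%R by rewrite subr_ge0 ler1n.
have h3 : ((q%:R - 1) * x <= (q%:R - 1) * N%:R)%R by apply: ler_wpM2l.
rewrite /x in h3; lra.
Qed.

Lemma no_copy_no_cycle (F : sgraph) (k : nat) (c : {set vert F} -> 'I_k)
    (Gs : k.-tuple sgraph) (i : 'I_k) (m : nat) :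
  ~ (exists i, has_copy (color_class c i) (tnth Gs i)) ->
  tnth Gs i = cycle_graph (2 * m) -> 0 < m -> ~ has_cycle (colour_rel c i) (2 * m).
Proof.
move=> none ti m0 hc; apply: none; exists i; rewrite ti; apply: cycle_copy hc.
by rewrite muln_gt0 m0.
Qed.

Lemma truncn_linear_gt (R : realType) (a : R) (M n : nat) : (0 < a)%R ->
  Num.truncn (M.+1%:R / a)%R < n -> M < Num.truncn (a * n%:R)%R.
Proof.
move=> a0 hn; rewrite truncn_gt_nat mulrC -ler_pdivrMr //.
have v0 : (0 <= M.+1%:R / a)%R by rewrite divr_ge0 // ltW.
by have /andP[_ /ltW h] := truncn_itv v0; apply: le_trans h _; rewrite ler_nat.
Qed.

Lemma no_room (R : realType) (q M v : nat) (x : R) :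
  q * v <= q * M + v -> (M%:R <= x)%R -> ~ (q%:R * x + v%:R < q%:R * v%:R)%R.
Proof.
rewrite -(ler_nat R) natrD !natrM => h Mx; apply/negP; rewrite -leNgt.
by apply: le_trans h _; rewrite lerD2r ler_wpM2l.
Qed.

Unset Implicit Arguments.
Local Open Scope ring_scope.

Theorem theorem3 (R : realType) (p a1 a2 a3 : R)
    (hp0 : 0 < p) (hp1 : p <= 1)
    (h12 : a2 <= a1) (h23 : a3 <= a2) (h3 : 0 < a3) :
  aas_gnp (2 * a1 + a2 + a3) p (fun n F =>
    arrows F [tuple cycle_graph (2 * Num.truncn (a1 * n%:R));
                    cycle_graph (2 * Num.truncn (a2 * n%:R));
                    cycle_graph (2 * Num.truncn (a3 * n%:R))])
  /\
  aas_gnp (2 * a1 + a2) p (fun n F =>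
    arrows F [tuple cycle_graph (2 * Num.truncn (a1 * n%:R));
                    cycle_graph (2 * Num.truncn (a2 * n%:R))]).
Proof.
have a20 : 0 < a2 by lra.
have a10 : 0 < a1 by lra.
have tr (a : R) (n : nat) : 0 < a -> (Num.truncn (a * n%:R))%:R <= a * n%:R.
  by move=> a0; rewrite truncn_le mulr_ge0 // ltW.
have trm (a b : R) (n : nat) : a <= b ->
    (Num.truncn (a * n%:R) <= Num.truncn (b * n%:R))%N.
  by move=> ab; apply: le_truncn; apply: ler_wpM2r.
split; apply: aas_gnp_of_quasirandom => //; try lra; move=> C q C0 q0;
  have [K [M0 [h [K0 h0 main]]]] := three_colour_cycles C0 q0.
  exists K, h, 0%N, (M0 + (Num.truncn (M0.+1%:R / a3)).+1)%N; split=> // n F hn hN KF qF hlt.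
  apply/forallP => c; apply/existsP; apply: contrapT => none.
  have [m1 e1] : exists m, m = Num.truncn (a1 * n%:R) by exists (Num.truncn (a1 * n%:R)).
  have [m2 e2] : exists m, m = Num.truncn (a2 * n%:R) by exists (Num.truncn (a2 * n%:R)).
  have [m3 e3] : exists m, m = Num.truncn (a3 * n%:R) by exists (Num.truncn (a3 * n%:R)).
  have l3 : (M0 < m3)%N.
    by rewrite e3; apply: truncn_linear_gt => //; apply: leq_trans hn; exact: leq_addl.
  have g23 : (m3 <= m2)%N by rewrite e2 e3 trm.
  have g12 : (m2 <= m1)%N by rewrite e1 e2 trm.
  have l2 := leq_trans l3 g23; have l1 := leq_trans l2 g12.
  rewrite -e1 -e2 -e3 in none.
  have pos m : (M0 < m)%N -> (0 < m)%N by exact: leq_ltn_trans.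
  have n1 := no_copy_no_cycle (i := ord0) (m := m1) none erefl (pos _ l1).
  have n2 := no_copy_no_cycle (i := lift ord0 ord0) (m := m2) none erefl (pos _ l2).
  have n3 := no_copy_no_cycle (i := lift ord0 (lift ord0 ord0)) (m := m3) none erefl (pos _ l3).
  have cover u v : edge_rel (edges F) u v -> [|| colour_rel c ord0 u v,
      colour_rel c (lift ord0 ord0) u v | colour_rel c (lift ord0 (lift ord0 ord0)) u v].
    rewrite /edge_rel /colour_rel => -> /=.
    case: (c [set u; v]) => [[|[|[|k]]] lt] //=.
  have := main (vert F) _ _ _ _ (quasirandom_graphP qF) cover
    (colour_rel_irr _ _) (colour_rel_irr _ _) (colour_rel_irr _ _)
    (colour_rel_sym _ _) (colour_rel_sym _ _) (colour_rel_sym _ _).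
  rewrite card_ord => /(_ KF (leq_trans (leq_addr _ _) hN) m1 m2 m3
    (ltnW l1) (ltnW l2) (ltnW l3) n1 n2 n3).
  rewrite (maxn_idPl g23) (maxn_idPl g12) => /no_room /(_ _ hlt); apply.
  rewrite !natrD e1 e2 e3; have := tr a1 n a10; have := tr a2 n a20; have := tr a3 n h3; lra.
(* The empty third colour enters with the constant half-length [M0.+1], whose contribution to the
   vertex bound is absorbed by [d]. *)
exists K, h, M0.+1, (M0 + (Num.truncn (M0.+1%:R / a2)).+1)%N; split=> // n F hn hN KF qF hlt.
apply/forallP => c; apply/existsP; apply: contrapT => none.
have [m1 e1] : exists m, m = Num.truncn (a1 * n%:R) by exists (Num.truncn (a1 * n%:R)).
have [m2 e2] : exists m, m = Num.truncn (a2 * n%:R) by exists (Num.truncn (a2 * n%:R)).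
have l2 : (M0 < m2)%N.
  by rewrite e2; apply: truncn_linear_gt => //; apply: leq_trans hn; exact: leq_addl.
have g12 : (m2 <= m1)%N by rewrite e1 e2 trm.
have l1 := leq_trans l2 g12.
rewrite -e1 -e2 in none.
have pos m : (M0 < m)%N -> (0 < m)%N by exact: leq_ltn_trans.
have n1 := no_copy_no_cycle (i := ord0) (m := m1) none erefl (pos _ l1).
have n2 := no_copy_no_cycle (i := lift ord0 ord0) (m := m2) none erefl (pos _ l2).
(* A positive length is essential: the empty sequence is a cycle of length 0. *)
have n3 : ~ has_cycle (fun _ _ : vert F => false) (2 * M0.+1).
  by case=> -[|x [|y w]] [] //=; rewrite mulnS.
have cover u v : edge_rel (edges F) u v -> [|| colour_rel c ord0 u v,
    colour_rel c (lift ord0 ord0) u v | false].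
  rewrite /edge_rel /colour_rel => -> /=.
  case: (c [set u; v]) => [[|[|k]] lt] //=.
have := main (vert F) _ _ _ _ (quasirandom_graphP qF) cover
  (colour_rel_irr _ _) (colour_rel_irr _ _) (fun _ => erefl)
  (colour_rel_sym _ _) (colour_rel_sym _ _) (fun _ _ => erefl).
rewrite card_ord => /(_ KF (leq_trans (leq_addr _ _) hN) m1 m2 M0.+1
  (ltnW l1) (ltnW l2) (leqnSn _) n1 n2 n3).
rewrite (maxn_idPl l2) (maxn_idPl g12) => /no_room /(_ _ hlt); apply.
rewrite !natrD e1 e2; have := tr a1 n a10; have := tr a2 n a20; lra.
Qed.
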